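(* Let $V$ be a vertex operator superalgebra equipped with a normalized scalar product $(\cdot|\cdot)$ and such that $V_0=\mathbb{C}\Omega$. Then the following are equivalent: (i) $(V,(\cdot|\cdot))$ is a unitary VOSA. (ii) $(V,(\cdot|\cdot))$ has unitary Möbius symmetry and local adjoints, that is, $V^{(\cdot|\cdot)}=V$.
   Context: **VOSA.** A vertex operator superalgebra (VOSA) $V=(V,\Omega,T,Y,\nu)$ consists of a complex vector superspace $V=V_{\bar 0}\oplus V_{\bar 1}$, an even vector $\Omega$ (vacuum), an even endomorphism $T$, and a linear parity-preserving map $a\mapsto Y(a,z)=\sum_{n\in\mathbb{Z}}a_{(n)}z^{-n-1}\in \mathrm{End}(V)[[z,z^{-1}]]$ such that for all $a,b$: $a_{(n)}b=0$ for $n$ large; $[T,Y(a,z)]=\frac{d}{dz}Y(a,z)$; $Y(\Omega,z)=1_V$, $T\Omega=0$, $a_{(-1)}\Omega=a$; $(z-w)^N[Y(a,z),Y(b,w)]=0$ for $N$ large, where $[Y(a,z),Y(b,w)]=Y(a,z)Y(b,w)-(-1)^{p(a)p(b)}Y(b,w)Y(a,z)$ is the graded commutator ($p$ = parity); together with an even vector $\nu$ (conformal vector) such that $L_n:=\nu_{(n+1)}$ satisfy the Virasoro relations with some central charge, $L_{-1}=T$, $L_0$ is diagonalizable with eigenspaces $V_n=\ker(L_0-n)$, $V_{\bar0}=\bigoplus_{n\in\mathbb{Z}}V_n$, $V_{\bar1}=\bigoplus_{n\in\mathbb{Z}-\frac12}V_n$, $\dim V_n<\infty$, $V_n=0$ for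 $n$ sufficiently negative. **Unitary VOSA.** A scalar product (positive-definite Hermitian form, linear in the second variable) is normalized if $(\Omega|\Omega)=1$. $(V,(\cdot|\cdot))$, with $(\cdot|\cdot)$ normalized, is a unitary VOSA if there is an antilinear bijection $\theta$ of $V$ preserving $(n)$-products, $\Omega$ and $\nu$, with $\theta^2=1$, such that $(Y(\theta(a),z)b|c)=(b|Y(e^{zL_1}(-1)^{2L_0^2+L_0}z^{-2L_0}a,z^{-1})c)$ for all $a,b,c\in V$. **Unitary Möbius symmetry and local adjoints.** $(V,(\cdot|\cdot))$ has unitary Möbius symmetry if $(L_na|b)=(a|L_{-n}b)$ for all $a,b\in V$, $n\in\{-1,0,1\}$. In this case every $a_{(n)}$ has an adjoint $a_{(n)}^+\in\mathrm{End}(V)$, $(b|a_{(n)}c)=(a_{(n)}^+b|c)$, and $Y(a,z)^+:=\sum_{n\in\mathbb{Z}}a_{(n)}^+z^{n+1}$ is a field on $V$. $Y(a,z)$ has a local adjoint if for every $b\in V$ there is $N\ge0$ with $(z-w)^N[Y(a,z)^+,Y(b,w)]=0$ (graded commutator). $V^{(\cdot|\cdot)}$ is the set of $a\in V$ such that $Y(a,z)$ has a local adjoint. *)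

(* Defs.v *)
From mathcomp Require Import all_boot all_order all_algebra.
From mathcomp Require Import boolp classical_sets functions cardinality fsbigop.
From mathcomp Require Import reals.
From mathcomp Require Import complex.

Set Implicit Arguments.
Unset Strict Implicit.
Unset Printing Implicit Defensive.

Import Order.TTheory GRing.Theory Num.Theory.

Local Open Scope classical_set_scope.
Local Open Scope ring_scope.

(* The complex numbers are [R[i]] with [R : realType]. [Z/2Z] is [bool], with
   [false] for even, [true] for odd, and addition [addb].

   The decomposition [V = V_0 (+) V_1] is given by its two projections
   [par false] and [par true]; [V_p] is the set of fixed points of [par p].
   [mode a n] is the endomorphism [a_(n)] in [Y(a,z) = sum_n a_(n) z^(-n-1)]. *)
Record vosa_data (R : realType) (V : lmodType R[i]) := VosaData {
  par : bool -> {linear V -> V};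
  vac : V;
  trans : {linear V -> V};
  mode : V -> int -> {linear V -> V};
  conf : V
}.

(* [F k] is the coefficient of [z ^ k]; respectively, [F k l] is the
   coefficient of [z ^ k * w ^ l]. *)
Definition distr (V : Type) := int -> V -> V.
Definition distr2 (V : Type) := int -> int -> V -> V.

Definition dz (R : realType) (V : lmodType R[i]) (F : distr V) : distr V :=
  fun k v => (k + 1)%:~R *: F (k + 1) v.

Definition mul_zw (V : zmodType) (F : distr2 V) : distr2 V :=
  fun k l v => F (k - 1) l v - F k (l - 1) v.

Section VosaTheory.
Variables (R : realType) (V : lmodType R[i]) (D : vosa_data V).

Definition homog (p : bool) : set V := [set a | par D p a = a].

(* The component of parity [p] of an endomorphism. *)
Definition op_par (p : bool) (A : V -> V) : V -> V :=
  fun v => \sum_(q : bool) par D (p (+) q) (A (par D q v)).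

(* The bilinear extension of [A B - (-1)^(p(A) p(B)) B A]. *)
Definition gcomm (A B : V -> V) : V -> V := fun v =>
  \sum_(p : bool) \sum_(q : bool)
    (op_par p A (op_par q B v)
     - (-1 : R[i]) ^+ (p && q) *: op_par q B (op_par p A v)).

Definition local_at (A B : distr V) (N : nat) : Prop :=
  forall k l v, iter N (@mul_zw V) (fun i j => gcomm (A i) (B j)) k l v = 0.

Definition Yz (a : V) : distr V := fun k => mode D a (- k - 1).

Definition L (n : int) : V -> V := mode D (conf D) (n + 1).

(* [wt_space k] is [V_(k/2)]: weights are doubled. *)
Definition wt_space (k : int) : set V :=
  [set a | L 0 a = (k%:~R / 2) *: a].

Definition wt_decomp (a : V) (h : int -> V) : Prop :=
  [/\ finite_set [set k | h k != 0],
      forall k, wt_space k (h k) &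
      a = \sum_(k \in [set: int]) h k].

(* The component of [a] in [V_(k/2)]; it exists and is unique in a VOSA. *)
Definition wt_proj (k : int) (a : V) : V :=
  xget 0 [set b | exists2 h, wt_decomp a h & b = h k].

Definition fin_dim (W : set V) : Prop :=
  exists (d : nat) (e : 'I_d -> V), (forall i, W (e i)) /\
    forall a, W a -> exists x : 'I_d -> R[i], a = \sum_(i < d) x i *: e i.

Definition virasoro (c : R[i]) : Prop := forall (m n : int) (v : V),
  L m (L n v) - L n (L m v) =
    (m - n)%:~R *: L (m + n) v
    + (if m + n == 0 then (c / 12 * (m ^+ 3 - m)%:~R) *: v else 0).

Record is_vosa : Prop := IsVosa {
  par_idem : forall p q a, par D p (par D q a) = if p == q then par D p a else 0;
  par_sum : forall a, par D false a + par D true a = a;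
  vac_even : homog false (vac D);
  trans_even : forall p a, homog p a -> homog p (trans D a);
  mode_linear : forall x a b n v,
    mode D (x *: a + b) n v = x *: mode D a n v + mode D b n v;
  mode_parity : forall p q a b n, homog p a -> homog q b ->
    homog (p (+) q) (mode D a n b);
  mode_field : forall a b, exists N : int,
    forall n, N <= n -> mode D a n b = 0;
  trans_cov : forall a k v, gcomm (trans D) (Yz a k) v = dz (Yz a) k v;
  vac_mode : forall k v, Yz (vac D) k v = if k == 0 then v else 0;
  trans_vac : trans D (vac D) = 0;
  mode_vac : forall a, mode D a (-1) (vac D) = a;
  locality : forall a b, exists N0 : nat,
    forall N, (N0 <= N)%N -> local_at (Yz a) (Yz b) N;
  conf_even : homog false (conf D);
  conf_vir : exists c, virasoro c;
  L_trans : forall v, L (-1) v = trans D v;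
  (* [V_p] is the sum, automatically direct, of the [V_(k/2)] with [k] of
     parity [p]; with [par_sum] this makes [L 0] diagonalizable. *)
  parity_wt : forall p a, homog p a <->
    exists2 h, wt_decomp a h & forall k : int, odd `|k|%N != p -> h k = 0;
  wt_fin_dim : forall k, fin_dim (wt_space k);
  wt_bounded : exists K : int, forall k, k < K -> wt_space k = [set 0]
}.

Variable ip : V -> V -> R[i].

(* Linear in the second variable. (The forms of [sesquilinear.v] are linear in
   the first one.) *)
Record scalar_product : Prop := ScalarProduct {
  ip_linear : forall a x b c, ip a (x *: b + c) = x * ip a b + ip a c;
  ip_herm : forall a b, ip a b = (ip b a)^*;
  ip_pos : forall a, a != 0 -> 0 < ip a a
}.

Definition normalized : Prop := ip (vac D) (vac D) = 1.

(* The coefficient of [z ^ m] in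
     [e^(z L_1) (-1)^(2 L_0^2 + L_0) z^(-2 L_0) a].
   On [V_(k/2)], [2 L_0^2 + L_0] is [k (k + 1) / 2] and [z^(-2 L_0)] is
   [z^(-k)]; the term [z^j L_1^j / j!] of the exponential then contributes
   to [z^m] for [k = j - m]. *)
Definition twist (a : V) (m : int) : V :=
  \sum_(j \in [set: nat])
    let k := j%:Z - m in
    ((j`!)%:R^-1 * (-1) ^ (k * (k + 1) %/ 2)%Z) *:
      iter j (L 1) (wt_proj k a).

(* The coefficient of [z ^ k] in [Y(X(z), z^-1) c], for the finite sum
   [X(z) = sum_m x_m z^m]. *)
Definition Yinv (x : int -> V) (k : int) (c : V) : V :=
  \sum_(m \in [set: int]) Yz (x m) (m - k) c.

Record is_pct (theta : V -> V) : Prop := IsPct {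
  pct_antilinear : forall x a b,
    theta (x *: a + b) = x^* *: theta a + theta b;
  pct_bij : bijective theta;
  pct_mode : forall a n b, theta (mode D a n b) = mode D (theta a) n (theta b);
  pct_vac : theta (vac D) = vac D;
  pct_conf : theta (conf D) = conf D;
  pct_inv : forall a, theta (theta a) = a;
  pct_invariance : forall a b c k,
    ip (Yz (theta a) k b) c = ip b (Yinv (twist a) k c)
}.

Definition unitary_vosa : Prop :=
  [/\ scalar_product, normalized & exists theta, is_pct theta].

Definition unitary_mobius : Prop := forall a b (n : int),
  n \in [:: -1; 0; 1] -> ip (L n a) b = ip a (L (- n) b).

Definition adjoint_of (A B : V -> V) : Prop :=
  forall b c, ip b (A c) = ip (B b) c.

(* [ap n] is [a_(n)^+] (unique, as [ip] is positive definite), and the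
   coefficient of [z ^ k] in [Y(a,z)^+ = sum_n a_(n)^+ z^(n+1)] is
   [ap (k - 1)]. *)
Definition has_local_adjoint (a : V) : Prop :=
  exists2 ap : int -> {linear V -> V},
    forall n, adjoint_of (mode D a n) (ap n) &
    forall b, exists N : nat, local_at (fun k => ap (k - 1)) (Yz b) N.

Definition loc_adj : set V := [set a | has_local_adjoint a].

End VosaTheory.

(* Main.v *)
(* If [V] is unitary, the modes of [Y(a,z)^+] are, by the invariance formula,
   finite combinations of modes of vectors of [V], hence local.

   Conversely, for [a] of weight [h/2] let [a^o_(n)] be the modes of
   [Y(e^(z L_1) (-1)^(2 L_0^2 + L_0) z^(-2 L_0) a, z^-1)]. By hypothesis they
   have adjoints, which form a field local with all [Y(b,w)] and covariant under
   [T], since [[L_1, a^o_(n)] = n a^o_(n-1)]. Goddard's uniqueness theorem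
   identifies that field with [Y(theta a, z)] for a unique vector [theta a], and
   the invariance formula holds by construction. Borcherds' identity for [a] and
   [b], applied with the first index shifted, gives the same expression for
   [(a_(n) b)^o] in terms of [a^o] and [b^o] as its adjoint form gives for
   [theta(a)_(n) theta(b)], so that [theta] preserves all products. It is an
   involution because the sums of [(-1)^j C(s,j)] over [j] vanish. Finally
   [nu' = theta(nu)] satisfies [nu'_(1) = L_0], [L_1 nu' = 0] and, by
   [V_0 = C Omega], [L_2 nu' in C Omega]; the commutator of [nu_(-1)] with
   [nu'_(1)] then yields [nu' = nu]. *)

From HB Require Import structures.
Require Import Defs.
From mathcomp Require Import all_boot all_order all_algebra.
From mathcomp Require Import boolp classical_sets cardinality fsbigop reals.
From mathcomp Require Import complex ring zify.

Set Implicit Arguments.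
Unset Strict Implicit.
Unset Printing Implicit Defensive.

Import Order.TTheory GRing.Theory Num.Theory.
Local Open Scope classical_set_scope.
Local Open Scope ring_scope.

(** * Generalized binomials and finite differences *)

(** The axioms offer locality only, so Borcherds' identity has to be derived. Its side with products
    of modes, as a function of the exponent [n] of [z - w], obeys a recursion (multiplication by
    [z - w] raises [n]) and vanishes for large [n]. Dong's lemma and the identity itself then follow
    by descending induction on [n], negative exponents included. Sums that are finite only on each
    vector are written as partial sums with a threshold beyond which they no longer change. In the
    converse, the hypothesis says nothing about the parity of the adjoints; it is recovered from
    orthogonality of the weight spaces, itself due to self-adjointness of [L 0]. The quadratic
    exponent [2 L_0^2 + L_0] is what makes [theta] multiplicative: adjoints reverse the two products
    of modes in Borcherds' identity, and the factors [(-1)^(p(a) p(b))] and [(-1)^(n+1)] by which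
    the sign at the weight of [a_(n) b] differs from the product of the signs at [a] and [b] undo
    this reversal. Positivity of the form excludes negative weights, which cuts the final commutator
    down to four terms. *)

Section GeneralizedBinomial.
Variable K : numFieldType.
Implicit Types (n : int) (l : nat).

(** Product form, so that negative [n] is allowed; ['C(n, l)] covers natural numbers only. *)
Definition gbin n l : K := \prod_(i < l) ((n - i%:Z)%:~R / i.+1%:R).

Lemma gbin0 n : gbin n 0 = 1.
Proof. by rewrite /gbin big_ord0. Qed.

Lemma gbin_absorb n l : l.+1%:R * gbin n l.+1 = (n - l%:Z)%:~R * gbin n l.
Proof.
rewrite /gbin big_ord_recr /= [LHS]mulrC -2!mulrA mulVf ?pnatr_eq0 //.
by rewrite mulr1 mulrC.
Qed.

Lemma gbinS n l : gbin (n + 1) l.+1 = gbin n l.+1 + gbin n l.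
Proof.
elim: l => [|l IH].
  by rewrite !gbin0 /gbin !big_ord1 /= !subr0 !invr1 !mulr1 rmorphD.
have nz : l.+2%:R != 0 :> K by rewrite pnatr_eq0.
apply: (mulfI nz); rewrite gbin_absorb IH !mulrDr gbin_absorb.
have -> : (n + 1 - l.+1%:Z) = n - l%:Z by lia.
rewrite -[in X in _ + X = _]gbin_absorb -mulrDl -mulrDl; congr (_ * _).
by rewrite -!natr1 !rmorphB /= -!pmulrn -!natr1; ring.
Qed.

Lemma gbin_nat (m l : nat) : gbin m%:Z l = 'C(m, l)%:R.
Proof.
elim: m l => [|m IH] [|l]; rewrite ?gbin0 ?bin0 //.
  by rewrite bin0n /gbin big_ord_recl /= subr0 mul0r mul0r.
by rewrite binS natrD -!IH -gbinS -PoszD addn1.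
Qed.

Lemma gbinN1 l : gbin (-1) l = (-1) ^+ l.
Proof.
elim: l => [|l IH]; first by rewrite gbin0.
have nz : l.+1%:R != 0 :> K by rewrite pnatr_eq0.
apply: (mulfI nz); rewrite gbin_absorb IH exprS.
have -> : (-1 - l%:Z) = - l.+1%:Z by lia.
by rewrite rmorphN /= -pmulrn mulN1r mulrN mulNr.
Qed.

End GeneralizedBinomial.

Lemma sum_triangle (V : zmodType) (f : nat -> nat -> V) (n : nat) :
  \sum_(s < n) \sum_(t < s.+1) f t (s - t)%N =
  \sum_(t < n) \sum_(u < n - t) f t u.
Proof.
elim: n => [|n IH]; first by rewrite !big_ord0.
rewrite big_ord_recr /= IH [RHS]big_ord_recr /= big_ord_recr /=.
rewrite addrA; congr (_ + _); last by rewrite subSnn big_ord1 subnn.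
rewrite -big_split; apply: eq_bigr => t _ /=.
by rewrite subSn ?big_ord_recr //=; exact: ltnW.
Qed.

Lemma sum_widen (V : nmodType) (m n : nat) (f : nat -> V) : (m <= n)%N ->
  (forall i, (m <= i)%N -> f i = 0) -> \sum_(i < n) f i = \sum_(i < m) f i.
Proof.
move=> mn f0; rewrite -!(big_mkord xpredT) (big_cat_nat _ mn) //=.
by rewrite [X in _ + X]big_nat_cond [X in _ + X]big1 ?addr0 // => i /andP[/andP[/f0]].
Qed.

(** Support in an [A] by [B] rectangle makes the sum over antidiagonals a sum over the rectangle. It
    serves to regroup products of truncated exponential series. *)
Lemma sum_square (V : zmodType) (f : nat -> nat -> V) (A B n : nat) :
  (forall t u, (A <= t)%N -> f t u = 0) ->
  (forall t u, (B <= u)%N -> f t u = 0) -> (A + B <= n)%N ->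
  \sum_(s < n) \sum_(t < s.+1) f t (s - t)%N =
  \sum_(t < A) \sum_(u < B) f t u.
Proof.
move=> fA fB ABn; rewrite sum_triangle.
rewrite (@sum_widen _ A n (fun t => \sum_(u < n - t) f t u)); first last.
- by move=> i Ai; apply: big1 => u _; rewrite fA.
- exact: leq_trans (leq_addr _ _) ABn.
apply: eq_bigr => t _; apply: sum_widen => [|u]; last exact: fB.
by have := ltn_ord t; lia.
Qed.

Section Differences.
Variable V : zmodType.

(* On coefficients of [z^(-r-1) w^(-k-1) u^(-q-1)], the operators [dif],
   [dif13] and [dif23] are the multiplications by [z - w], [z - u] and [w - u]. *)
Definition dif (f : int -> int -> V) : int -> int -> V :=
  fun r k => f (r + 1) k - f r (k + 1).

Definition dif13 (f : int -> int -> int -> V) : int -> int -> int -> V :=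
  fun r k q => f (r + 1) k q - f r k (q + 1).

Definition dif23 (f : int -> int -> int -> V) : int -> int -> int -> V :=
  fun r k q => f r (k + 1) q - f r k (q + 1).

Lemma dif_iter0 N f : (forall r k, f r k = 0) -> forall r k, iter N dif f r k = 0.
Proof. by move=> f0; elim: N => //= N IH r k; rewrite /dif !IH subrr. Qed.

Lemma dif_iterD N f g r k :
  iter N dif (fun r k => f r k + g r k) r k = iter N dif f r k + iter N dif g r k.
Proof. by elim: N r k => //= N IH r k; rewrite /dif !IH opprD addrACA. Qed.

Lemma dif_iter_mono N M f : (N <= M)%N -> (forall r k, iter N dif f r k = 0) ->
  forall r k, iter M dif f r k = 0.
Proof. by move=> /subnK <- f0; rewrite iterD; exact: dif_iter0. Qed.

Lemma dif_iter_shift N f a b r k :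
  iter N dif (fun r k => f (r + a) (k + b)) r k = iter N dif f (r + a) (k + b).
Proof.
elim: N r k => //= N IH r k; rewrite /dif !IH.
by rewrite (addrAC r) (addrAC k).
Qed.

Lemma dif13_23 f : dif13 (dif23 f) = dif23 (dif13 f).
Proof.
apply/funext => r; apply/funext => k; apply/funext => q.
by rewrite /dif13 /dif23 !opprB addrACA [in RHS]addrACA [- _ + _]addrC.
Qed.

Lemma dif13_23_iter N M f :
  iter N dif13 (iter M dif23 f) = iter M dif23 (iter N dif13 f).
Proof.
have H1 g : dif13 (iter M dif23 g) = iter M dif23 (dif13 g).
  by elim: M => //= m IH; rewrite dif13_23 IH.
by elim: N => //= n ->.
Qed.

Lemma dif23_iterE N f r k q :
  iter N dif23 f r k q = iter N dif (f r) k q.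
Proof. by elim: N k q => //= N IH k q; rewrite /dif23 !IH. Qed.

Lemma dif13_iterE N f r k q :
  iter N dif13 f r k q = iter N dif (fun r q => f r k q) r q.
Proof. by elim: N r q => //= N IH r q; rewrite /dif13 !IH. Qed.

End Differences.

(** * Borcherds' identity from locality *)

Section Dong.
Variables (K : numFieldType) (V : lmodType K).
Implicit Types (x y c : int -> {linear V -> V}).

(** Locality in terms of modes. The sign of the graded commutator is a scalar [s], so that no parity
    is involved and Dong's lemma can simply multiply the signs. *)
Definition mlocal (s : K) (A B : int -> V -> V) (N : nat) : Prop :=
  forall v r k, iter N (@dif V)
    (fun r k => A r (B k v) - s *: B k (A r v)) r k = 0.

Lemma mloc_mono s A B N M : (N <= M)%N -> mlocal s A B N -> mlocal s A B M.
Proof. by move=> NM H v; exact: dif_iter_mono NM (H v). Qed.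

Lemma dif_iter_additive N (A : {additive V -> V}) f r k :
  iter N (@dif V) (fun r k => A (f r k)) r k = A (iter N (@dif V) f r k).
Proof. by elim: N r k => //= N IH r k; rewrite /dif !IH raddfB. Qed.

(* The vector [C (-1) u] appears as the value at [w = 0] of [C(w) u]. *)
Lemma goddard (E C : int -> V -> V) (u : V) (s : K) (N : nat) :
  (forall k, E k u = 0) -> (forall k, E k 0 = 0) -> (forall k, C k 0 = 0) ->
  (forall k, 0 <= k -> C k u = 0) -> mlocal s E C N ->
  forall k, E k (C (-1) u) = 0.
Proof.
move=> Eu E0 C0 Cu loc k.
(* Each [dif] raises either [r] or [k]. As [C k u] vanishes for [k >= 0], at [k = -1] only the term
   with all [M] steps in [r] survives. *)
have key M r : (forall k, 0 <= k -> iter M (@dif V) (fun r k => E r (C k u)) r k = 0) /\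
    iter M (@dif V) (fun r k => E r (C k u)) r (-1) = E (r + M%:Z) (C (-1) u).
  elim: M r => [|M IH] r /=; first by rewrite addr0; split => // j /Cu ->.
  split=> [j j0|]; rewrite /dif.
    by rewrite (IH _).1 // (IH _).1 ?subrr //; lia.
  rewrite (IH _).2 (IH r).1 // subr0; congr (E _ _); lia.
have := loc u (k - N%:Z) (-1).
suff -> : (fun r k => E r (C k u) - s *: C k (E r u)) = fun r k => E r (C k u).
  by rewrite (key N _).2 subrK.
by apply/funext => i; apply/funext => j; rewrite Eu C0 scaler0 subr0.
Qed.

(** The coefficient of [x^l] in [(1 - x)^n]. *)
Definition sgbin (n : int) (l : nat) : K := (-1) ^+ l * gbin K n l.

Lemma sgbin0 n : sgbin n 0 = 1. Proof. by rewrite /sgbin gbin0 mulr1. Qed.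

Lemma sgbinS n l : sgbin (n + 1) l.+1 = sgbin n l.+1 - sgbin n l.
Proof. by rewrite /sgbin gbinS exprS; ring. Qed.

(** Summation by parts, from [(1 - x)^(n+1) = (1 - x) (1 - x)^n]. The boundary term disappears as
    soon as [L] is past the cutoff of the fields. *)
Lemma abel n (C : nat -> V) L :
  \sum_(l < L.+1) sgbin (n + 1) l *: C l =
  \sum_(l < L.+1) sgbin n l *: (C l - C l.+1) + sgbin n L *: C L.+1.
Proof.
elim: L => [|L IH]; first by rewrite !big_ord1 !sgbin0 scalerBr subrK.
rewrite big_ord_recr IH [in RHS]big_ord_recr /= -!addrA; congr (_ + _).
by rewrite scalerBr subrK sgbinS scalerBl addrC subrK.
Qed.

(** The side of Borcherds' identity that consists of products of modes, after [L] terms; for fields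
    [x] and [y] it is constant in [L] from some point on, depending on [v]. *)
Definition borcherds_partial s x y (L : nat) (r n k : int) (v : V) : V :=
  \sum_(l < L) sgbin n l *: (x (r + n - l%:Z) (y (k + l%:Z) v)
     - (s * (-1) ^ n) *: y (n + k - l%:Z) (x (r + l%:Z) v)).

Section Cutoff.
Variables (s : K) (x y : int -> {linear V -> V}) (cx cy : V -> int).
Hypothesis hx : forall v n, cx v <= n -> x n v = 0.
Hypothesis hy : forall v n, cy v <= n -> y n v = 0.

Definition cutoff r k v : nat := (`|cx v - r|%N + `|cy v - k|%N)%N.

(* The coefficients of
   [i_(z,w) (z-w)^n x(z) y(w) - s i_(w,z) (z-w)^n y(w) x(z)]. *)
Definition borcherds_coef r n k v := borcherds_partial s x y (cutoff r k v) r n k v.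

Lemma borcherds_coef_stable L r n k v :
  (cutoff r k v <= L)%N -> borcherds_partial s x y L r n k v =
  borcherds_coef r n k v.
Proof.
move=> cL; apply: (@sum_widen _ _ _ (fun l => sgbin n l *: (x (r + n - l%:Z) (y (k + l%:Z) v)
     - (s * (-1) ^ n) *: y (n + k - l%:Z) (x (r + l%:Z) v)))) => // i.
rewrite /cutoff => ci; rewrite (hy (v := v)); last by lia.
rewrite (hx (v := v)); last by lia.
by rewrite !linear0 addr0 linear0.
Qed.

(** Both expansions of [(z - w)^n] become those of [(z - w)^(n+1)] under multiplication by [z - w],
    for every integer [n]. *)
Lemma borcherds_coef_rec r n k v :
  borcherds_coef (r + 1) n k v - borcherds_coef r n (k + 1) v =
  borcherds_coef r (n + 1) k v.
Proof.
pose L := (cutoff r k v).+1.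
rewrite -(@borcherds_coef_stable L.+1 (r + 1)); last by rewrite /L /cutoff; lia.
rewrite -(@borcherds_coef_stable L.+1 r n); last by rewrite /L /cutoff; lia.
rewrite -(@borcherds_coef_stable L.+1 r (n + 1)); last by rewrite /L /cutoff; lia.
pose C l : V := x (r + 1 + n - l%:Z) (y (k + l%:Z) v)
     + (s * (-1) ^ n) *: y (n + k + 1 - l%:Z) (x (r + l%:Z) v).
transitivity (\sum_(l < L.+1) sgbin (n + 1) l *: C l); first last.
  apply: eq_bigr => l _; congr (_ *: _); rewrite /C exprzDr ?unitrN1 //.
  rewrite expr1z mulrN1 mulrN scaleNr opprK.
  by rewrite (addrAC r 1) addrA (addrAC n k).
rewrite abel [C _]/C (hy (v := v)); last by rewrite /L /cutoff; lia.
rewrite (hx (v := v)); last by rewrite /L /cutoff; lia.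
rewrite !linear0 addr0 linear0 addr0 -sumrB.
apply: eq_bigr => l _; rewrite -scalerBr; congr (_ *: _); rewrite /C.
have e1 : r + 1 + n - l.+1%:Z = r + n - l%:Z by lia.
have e2 : k + l.+1%:Z = k + 1 + l%:Z by lia.
have e3 : n + k + 1 - l.+1%:Z = n + k - l%:Z by lia.
have e4 : r + l.+1%:Z = r + 1 + l%:Z by lia.
rewrite e1 e2 e3 e4 addrA.
set b := _ *: y (n + k - l%:Z) _; set d := _ *: y (n + k + 1 - l%:Z) _.
by rewrite opprB opprD [- x _ _ - b]addrC addrACA.
Qed.

Lemma borcherds_coef0 r k v :
  borcherds_coef r 0 k v = x r (y k v) - s *: y k (x r v).
Proof.
rewrite -(@borcherds_coef_stable (cutoff r k v).+1) ?leqnSn // /borcherds_partial big_ord_recl big1 => [|l _].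
  by rewrite /= sgbin0 scale1r !subr0 !addr0 add0r expr0z mulr1.
by rewrite /sgbin lift0 gbin_nat bin0n mulr0 scale0r.
Qed.

Lemma borcherds_coef_nat (n : nat) r k v :
  borcherds_coef r n k v = iter n (@dif V) (fun r k => x r (y k v) - s *: y k (x r v)) r k.
Proof.
elim: n r k => [|n IH] r k; first exact: borcherds_coef0.
by rewrite -addn1 PoszD -borcherds_coef_rec !IH addn1.
Qed.

Lemma borcherds_coef_loc N n :
  mlocal s x y N -> N%:Z <= n -> forall r k v, borcherds_coef r n k v = 0.
Proof.
case: n => // n loc Nn r k v; rewrite borcherds_coef_nat.
by apply: dif_iter_mono (loc v) _ _; lia.
Qed.

Lemma borcherds_coef_linear r n k a u v :
  borcherds_coef r n k (a *: u + v) =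
  a *: borcherds_coef r n k u + borcherds_coef r n k v.
Proof.
pose L := (cutoff r k (a *: u + v) + cutoff r k u + cutoff r k v)%N.
rewrite -!(@borcherds_coef_stable L); try by rewrite /L; lia.
rewrite /borcherds_partial scaler_sumr -big_split; apply: eq_bigr => l _ /=.
move: (sgbin n l) => b; set sg := s * _; set p := r + n - _; set q := n + k - _.
rewrite (linearP (y (k + _))) (linearP (x p)) (linearP (x (r + _))) (linearP (y q)).
rewrite [sg *: _]scalerDr [sg *: (a *: _)]scalerA [sg * a]mulrC -[(a * sg) *: _]scalerA opprD addrACA.
by rewrite -scalerBr scalerDr scalerA mulrC -scalerA.
Qed.

End Cutoff.

End Dong.

(** * Difference operators in three variables *)

Section DifferenceIteration.
Variable V : zmodType.
Implicit Type F : nat -> int -> int -> int -> V.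

(** Pointwise stabilization replaces convergence. Difference operators involve finitely many
    coefficients, hence commute with it. *)
Definition eventually_eq F (f : int -> int -> int -> V) : Prop :=
  forall r k q, exists L0, forall L, (L0 <= L)%N -> F L r k q = f r k q.

Lemma eventually_eq13 N F f : eventually_eq F f ->
  eventually_eq (fun L => iter N (@dif13 V) (F L)) (iter N (@dif13 V) f).
Proof.
move=> Ff; elim: N => //= N IH r k q.
have [L1 h1] := IH (r + 1) k q; have [L2 h2] := IH r k (q + 1).
exists (maxn L1 L2) => L; rewrite geq_max => /andP[l1 l2].
by rewrite /dif13 h1 ?h2.
Qed.

Lemma eventually_eq23 N F f : eventually_eq F f ->
  eventually_eq (fun L => iter N (@dif23 V) (F L)) (iter N (@dif23 V) f).
Proof.
move=> Ff; elim: N => //= N IH r k q.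
have [L1 h1] := IH r (k + 1) q; have [L2 h2] := IH r k (q + 1).
exists (maxn L1 L2) => L; rewrite geq_max => /andP[l1 l2].
by rewrite /dif23 h1 ?h2.
Qed.

Lemma dif13_iterD N f g : iter N (@dif13 V) (fun r k q => f r k q + g r k q) =
  (fun r k q => iter N (@dif13 V) f r k q + iter N (@dif13 V) g r k q).
Proof.
elim: N => //= N ->; apply/funext => r; apply/funext => k; apply/funext => q.
by rewrite /dif13 opprD addrACA.
Qed.

Lemma dif23_iterD N f g : iter N (@dif23 V) (fun r k q => f r k q + g r k q) =
  (fun r k q => iter N (@dif23 V) f r k q + iter N (@dif23 V) g r k q).
Proof.
elim: N => //= N ->; apply/funext => r; apply/funext => k; apply/funext => q.
by rewrite /dif23 opprD addrACA.
Qed.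

Lemma dif13_iter_additive N (A : {additive V -> V}) f :
  iter N (@dif13 V) (fun r k q => A (f r k q)) =
  fun r k q => A (iter N (@dif13 V) f r k q).
Proof.
elim: N => //= N ->; apply/funext => r; apply/funext => k; apply/funext => q.
by rewrite /dif13 raddfB.
Qed.

Lemma dif23_iter_additive N (A : {additive V -> V}) f :
  iter N (@dif23 V) (fun r k q => A (f r k q)) =
  fun r k q => A (iter N (@dif23 V) f r k q).
Proof.
elim: N => //= N ->; apply/funext => r; apply/funext => k; apply/funext => q.
by rewrite /dif23 raddfB.
Qed.

Lemma dif13_iter_shift N a b f :
  iter N (@dif13 V) (fun r k q => f (r + a) (k + b) q) =
  fun r k q => iter N (@dif13 V) f (r + a) (k + b) q.
Proof.
elim: N => //= N ->; apply/funext => r; apply/funext => k; apply/funext => q.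
by rewrite /dif13 (addrAC r).
Qed.

Lemma dif23_iter_shift N a b f :
  iter N (@dif23 V) (fun r k q => f (r + a) (k + b) q) =
  fun r k q => iter N (@dif23 V) f (r + a) (k + b) q.
Proof.
elim: N => //= N ->; apply/funext => r; apply/funext => k; apply/funext => q.
by rewrite /dif23 (addrAC k).
Qed.

(** Annihilation by [(z - u)^N (w - u)^N]. *)
Definition killed N (f : int -> int -> int -> V) : Prop :=
  forall r k q, iter N (@dif23 V) (iter N (@dif13 V) f) r k q = 0.

Lemma killedD N f g : killed N f -> killed N g ->
  killed N (fun r k q => f r k q + g r k q).
Proof.
by move=> Hf Hg r k q; rewrite dif13_iterD dif23_iterD Hf Hg addr0.
Qed.

Lemma killed_additive N (A : {additive V -> V}) f :
  killed N f -> killed N (fun r k q => A (f r k q)).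
Proof.
by move=> Hf r k q; rewrite dif13_iter_additive dif23_iter_additive Hf raddf0.
Qed.

Lemma killed_shift N a b f :
  killed N f -> killed N (fun r k q => f (r + a) (k + b) q).
Proof. by move=> Hf r k q; rewrite dif13_iter_shift dif23_iter_shift Hf. Qed.

Lemma killed0 N : killed N (fun _ _ _ => 0).
Proof.
move=> r k q; rewrite dif23_iterE; apply: dif_iter0 => k' q'.
by rewrite dif13_iterE; exact: dif_iter0.
Qed.

Lemma killed_sum N L (F : nat -> int -> int -> int -> V) :
  (forall l, killed N (F l)) -> killed N (fun r k q => \sum_(l < L) F l r k q).
Proof.
move=> HF; elim: L => [|L IH].
  rewrite (_ : (fun _ _ _ => _) = fun _ _ _ => 0); first exact: killed0.
  by apply/funext => r; apply/funext => k; apply/funext => q; rewrite big_ord0.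
rewrite (_ : (fun _ _ _ => _) =
  fun r k q => \sum_(l < L) F l r k q + F L r k q); first exact: killedD.
by apply/funext => r; apply/funext => k; apply/funext => q; rewrite big_ord_recr.
Qed.

Lemma killed_eventually N F f : eventually_eq F f ->
  (forall L, killed N (F L)) -> killed N f.
Proof.
move=> Ff HF r k q.
have [L0 /(_ L0 (leqnn _))] := eventually_eq23 N (eventually_eq13 N Ff) r k q.
by rewrite HF.
Qed.

Lemma killed_dif13 N f :
  (forall r k q, iter N (@dif13 V) f r k q = 0) -> killed N f.
Proof.
move=> H r k q; rewrite dif23_iterE; apply: dif_iter0 => k' q'; exact: H.
Qed.

Lemma killed_dif23 N f :
  (forall r k q, iter N (@dif23 V) f r k q = 0) -> killed N f.
Proof.
move=> H r k q; rewrite -dif13_23_iter dif13_iterE.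
apply: dif_iter0 => k' q'; exact: H.
Qed.

End DifferenceIteration.

(** * Dong's lemma *)

Section DongLemma.
Variables (K : numFieldType) (V : lmodType K).
Variables (x y c : int -> {linear V -> V}) (cx cy : V -> int).
Hypothesis hx : forall v n, cx v <= n -> x n v = 0.
Hypothesis hy : forall v n, cy v <= n -> y n v = 0.
Variables (sxy sxc syc : K) (N : nat).
Hypothesis loc_xy : mlocal sxy x y N.
Hypothesis loc_xc : mlocal sxc x c N.
Hypothesis loc_yc : mlocal syc y c N.

Let t := sxc * syc.
Let coefxy := borcherds_coef sxy x y cx cy.

Let f v n r k q := coefxy r n k (c q v) - t *: c q (coefxy r n k v).

(** The derivation rule [[x y, c] = x [y, c] + syc [x, c] y]: the first term is killed by
    [(w - u)^N], the second by [(z - u)^N]. *)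
Lemma killed_triple_xy v :
  killed N (fun r k q => x r (y k (c q v)) - t *: c q (x r (y k v))).
Proof.
rewrite (_ : (fun _ _ _ => _) = fun r k q =>
    x r (y k (c q v) - syc *: c q (y k v)) +
    syc *: (x r (c q (y k v)) - sxc *: c q (x r (y k v)))); last first.
  apply/funext => r; apply/funext => k; apply/funext => q.
  by rewrite (linearB (x r)) (linearZ_LR (x r)) /= scalerBr addrA subrK scalerA mulrC.
apply: killedD.
  apply: killed_dif23 => r k q; rewrite dif23_iterE.
  by rewrite (@dif_iter_additive _ _ _ (x r)) loc_yc raddf0.
apply: (@killed_additive _ N ( *:%R syc)).
by apply: killed_dif13 => r k q; rewrite dif13_iterE loc_xc.
Qed.

Lemma killed_triple_yx v :
  killed N (fun r k q => y k (x r (c q v)) - t *: c q (y k (x r v))).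
Proof.
rewrite (_ : (fun _ _ _ => _) = fun r k q =>
    y k (x r (c q v) - sxc *: c q (x r v)) +
    sxc *: (y k (c q (x r v)) - syc *: c q (y k (x r v)))); last first.
  apply/funext => r; apply/funext => k; apply/funext => q.
  by rewrite (linearB (y k)) (linearZ_LR (y k)) /= scalerBr addrA subrK scalerA.
apply: killedD.
  apply: killed_dif13 => r k q; rewrite dif13_iterE.
  by rewrite (@dif_iter_additive _ _ _ (y k)) loc_xc raddf0.
apply: (@killed_additive _ N ( *:%R sxc)).
by apply: killed_dif23 => r k q; rewrite dif23_iterE loc_yc.
Qed.

(** Every summand of [coefxy] is a shift in [r] and [k] of one of the two triple products above. The
    exponent [N] is insensitive to shifts, hence the same for all [n]. *)
Lemma killed_commutator v n : killed N (f v n).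
Proof.
pose F L r k q := borcherds_partial sxy x y L r n k (c q v) - t *: c q (borcherds_partial sxy x y L r n k v).
apply: (@killed_eventually _ _ F) => [r k q|L].
  exists (cutoff cx cy r k (c q v) + cutoff cx cy r k v)%N => L cL.
  by rewrite /F /f /coefxy !(borcherds_coef_stable sxy hx hy) //; lia.
pose g1 r k q := x r (y k (c q v)) - t *: c q (x r (y k v)).
pose g2 r k q := y k (x r (c q v)) - t *: c q (y k (x r v)).
pose s := sxy * (-1) ^ n.
pose G l r k q := sgbin K n l *: (g1 (r + (n - l%:Z)) (k + l%:Z) q +
    (- s) *: g2 (r + l%:Z) (k + (n - l%:Z)) q).
rewrite (_ : F L = fun r k q => \sum_(l < L) G l r k q).
  apply: killed_sum => l; apply: (@killed_additive _ N ( *:%R (sgbin K n l))).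
  apply: killedD; first exact/(killed_shift _ _ (killed_triple_xy v)).
  apply: (@killed_additive _ N ( *:%R (- s))).
  exact/(killed_shift _ _ (killed_triple_yx v)).
apply/funext => r; apply/funext => k; apply/funext => q.
rewrite /F /borcherds_partial linear_sum scaler_sumr -sumrB; apply: eq_bigr => l _ /=.
rewrite /G; move: (sgbin K n l) => b.
rewrite (linearZ_LR (c q)) /= [t *: (b *: _)]scalerA [t * _]mulrC.
rewrite -[(b * t) *: _]scalerA -scalerBr; congr (_ *: _);
  rewrite (linearB (c q)) (linearZ_LR (c q)) /= /g1 /g2.
rewrite (addrA r) (addrA k) (addrC k n) -/s.
rewrite scaleNr !scalerBr !opprB !scalerA (mulrC t s).
by rewrite [(s * t) *: _ - t *: _]addrC addrACA [- (s *: _) + _]addrC.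
Qed.

(* Descending induction on [n]: if [(w-u)^M] kills [f (n + 1) = (z-w) (f n)], then
   [z - u] and [w - u] act alike on [(w-u)^M (f n)], and [killed_commutator] turns
   into the vanishing of [(w-u)^(2N+M) (f n)]. *)
Lemma dif23_iter_commutator m : forall v n, N%:Z <= n + m%:Z ->
  forall r k q, iter (m * (N + N)) (@dif23 V) (f v n) r k q = 0.
Proof.
elim: m => [|m IH] v n Nn r k q /=.
  rewrite addr0 in Nn.
  by rewrite /f /coefxy !(borcherds_coef_loc hx hy loc_xy) // linear0 scaler0 subr0.
set M := (m * (N + N))%N.
pose g := iter M (@dif23 V) (f v n).
have gE r' k' q' : g (r' + 1) k' q' = g r' (k' + 1) q'.
  apply/eqP; rewrite -subr_eq0; apply/eqP.
  have <- : iter M (@dif23 V) (f v (n + 1)) r' k' q' = 0 by apply: IH; lia.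
  rewrite /g !dif23_iterE.
  have -> : f v (n + 1) r' = fun k q => f v n (r' + 1) k q + - f v n r' (k + 1) q.
    apply/funext => k1; apply/funext => q1; rewrite /f /coefxy.
    by rewrite -!(borcherds_coef_rec sxy hx hy) (linearB (c q1)) /= scalerBr opprD addrACA -opprD.
  rewrite (@dif_iterD _ M (f v n (r' + 1)) (fun k q => - f v n r' (k + 1) q)).
  rewrite (@dif_iter_additive _ _ M -%R (fun k q => f v n r' (k + 1) q)).
  congr (_ - _).
  have := dif_iter_shift M (f v n r') 1 0 k' q'; rewrite addr0 => <-.
  by congr (iter _ _ _ _ _); apply/funext => k1; apply/funext => q1; rewrite addr0.
have g13 : dif13 g = dif23 g.
  by apply/funext => r1; apply/funext => k1; apply/funext => q1;
     rewrite /dif13 /dif23 gE.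
have gN j : iter j (@dif13 V) g = iter j (@dif23 V) g.
  elim: j => //= j ->.
  by rewrite -[dif13 _]/(iter 1 (@dif13 V) _) dif13_23_iter /= g13 -iterSr.
rewrite (_ : (m.+1 * (N + N))%N = (N + N + M)%N); last by rewrite /M; lia.
rewrite iterD -/g iterD -gN /g.
rewrite dif13_23_iter -iterD addnC iterD.
rewrite dif23_iterE; apply: dif_iter0 => k1 q1; exact: killed_commutator.
Qed.


(** At [r = 0] one takes the residue in [z], so [coefxy 0 n] is the [n]-th product of the two
    fields. *)
Lemma dong n : exists M, mlocal t (fun k => coefxy 0 n k) c M.
Proof.
exists (`|N%:Z - n| * (N + N))%N => v k q.
by have := @dif23_iter_commutator `|N%:Z - n| v n _ 0 k q; rewrite dif23_iterE => -> //; lia.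
Qed.

End DongLemma.

(** * First consequences of the axioms *)

Section VosaBasics.
Variables (R : realType) (V : lmodType R[i]) (D : vosa_data V).
Hypothesis HV : is_vosa D.

Local Notation K := R[i].
Local Notation mo := (mode D).
Local Notation T := (trans D).
Local Notation vc := (vac D).
Local Notation pr := (par D).
Local Notation LL := (L D).

Lemma modeD a b n v : mo (a + b) n v = mo a n v + mo b n v.
Proof. by have := mode_linear HV 1 a b n v; rewrite !scale1r. Qed.

Lemma mode0 n v : mo 0 n v = 0.
Proof. by apply: (@addrI _ (mo 0 n v)); rewrite -modeD !addr0. Qed.

Lemma modeZ x a n v : mo (x *: a) n v = x *: mo a n v.
Proof. by have := mode_linear HV x a 0 n v; rewrite addr0 mode0 addr0. Qed.

Lemma mode_sum (I : Type) (r : seq I) (P : pred I) (F : I -> V) n v :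
  mo (\sum_(i <- r | P i) F i) n v = \sum_(i <- r | P i) mo (F i) n v.
Proof.
elim/big_rec2: _ => [|i y1 y2 _ <-]; first exact: mode0.
by rewrite modeD.
Qed.

Definition has_par p (A : V -> V) : Prop :=
  forall q v, homog D q v -> homog D (p (+) q) (A v).

Lemma homog_par p v : homog D p (pr p v).
Proof. by rewrite /homog /= (par_idem HV) eqxx. Qed.

Lemma par_homog p q v : homog D q v -> pr p v = if p == q then v else 0.
Proof. by move=> hv; rewrite -{1}hv (par_idem HV); case: eqP => // ->. Qed.

Lemma sum_par v : \sum_(q : bool) pr q v = v.
Proof. by rewrite big_bool /= addrC (par_sum HV). Qed.

Lemma homog_add p u v : homog D p u -> homog D p v -> homog D p (u + v).
Proof. by rewrite /homog /= linearD => -> ->. Qed.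

Lemma homog0 p : homog D p 0. Proof. exact: linear0. Qed.

Lemma op_par_has p p' (A : {linear V -> V}) v : has_par p A ->
  op_par D p' A v = if p' == p then A v else 0.
Proof.
move=> hA; rewrite /op_par.
transitivity (\sum_(q : bool) if p' == p then A (pr q v) else 0).
  apply: eq_bigr => q _; rewrite (par_homog _ (hA _ _ (homog_par q v))).
  by case: p p' q {hA} => [] [] [].
by case: eqP => _; [rewrite -linear_sum sum_par|exact: big1].
Qed.

(** [gcomm] sums over all pairs of parity components; for homogeneous operators a single pair
    contributes. *)
Lemma gcomm_has p q (A B : {linear V -> V}) v : has_par p A -> has_par q B ->
  gcomm D A B v = A (B v) - (-1) ^+ (p && q) *: B (A v).
Proof.
move=> hA hB; rewrite /gcomm (bigD1 p) //= [X in _ + X]big1 ?addr0; last first.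
  move=> p' np; apply: big1 => q' _.
  rewrite !(op_par_has _ _ hA) (negbTE np).
  by rewrite (op_par_has _ _ hB); case: ifP; rewrite !linear0 addr0.
rewrite (bigD1 q) //= [X in _ + X]big1 ?addr0; last first.
  move=> q' nq; rewrite !(op_par_has _ _ hB) (negbTE nq).
  by rewrite (op_par_has _ _ hA) eqxx !linear0 addr0.
by rewrite !(op_par_has _ _ hA) !(op_par_has _ _ hB) !eqxx.
Qed.

Lemma flipK (n : int) : - (- n - 1) - 1 = n. Proof. by lia. Qed.

(** The substitution [k = - r - 1] between exponents and mode indices turns multiplication by
    [z - w] into [dif]. *)
Lemma mul_zw_iter N (F : distr2 V) k l v :
  iter N (@mul_zw V) F k l v =
  iter N (@dif V) (fun r s => F (- r - 1) (- s - 1) v) (- k - 1) (- l - 1).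
Proof.
elim: N k l => [|N IH] k l /=; first by rewrite !flipK.
rewrite /mul_zw /dif !IH; congr (_ - _).
  by congr (iter _ _ _ _ _); lia.
by congr (iter _ _ _ _ _); lia.
Qed.

Lemma local_mloc p q (A B : int -> {linear V -> V}) N :
  (forall n, has_par p (A n)) -> (forall n, has_par q (B n)) ->
  local_at D A B N <->
  mlocal ((-1) ^+ (p && q)) (fun n => A (- n - 1)) (fun n => B (- n - 1)) N.
Proof.
move=> hA hB; have key v : (fun r s => gcomm D (A (- r - 1)) (B (- s - 1)) v) =
   fun r s => A (- r - 1) (B (- s - 1) v) -
      (-1) ^+ (p && q) *: B (- s - 1) (A (- r - 1) v).
  by apply/funext => r; apply/funext => s; rewrite (gcomm_has _ (hA _) (hB _)).
split=> [H v r s|H k l v].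
  have := H (- r - 1) (- s - 1) v; rewrite mul_zw_iter key.
  by rewrite !flipK.
by rewrite mul_zw_iter key H.
Qed.

Lemma mode_has_par p a n : homog D p a -> has_par p (mo a n).
Proof. by move=> ha q v hv; exact: (mode_parity HV). Qed.

Lemma mode_mloc p q a b : homog D p a -> homog D q b ->
  exists N, mlocal ((-1) ^+ (p && q)) (mo a) (mo b) N.
Proof.
move=> ha hb; have [N /(_ N (leqnn N)) loc] := locality HV a b.
exists N => v r k.
have [+ _] := @local_mloc p q (fun k => mo a (- k - 1)) (fun k => mo b (- k - 1))
  N (fun n => mode_has_par _ ha) (fun n => mode_has_par _ hb).
move=> /(_ loc v r k).
by congr (iter _ _ _ _ _ = _); apply/funext => i; apply/funext => j; rewrite !flipK.
Qed.

Lemma trans_has_par : has_par false T.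
Proof. by move=> q v; rewrite addFb; exact: (trans_even HV). Qed.

Lemma trans_mode a n v : T (mo a n v) = mo a n (T v) - n%:~R *: mo a (n - 1) v.
Proof.
have main p u : homog D p u -> T (mo u n v) = mo u n (T v) - n%:~R *: mo u (n - 1) v.
  move=> hu; have := trans_cov HV u (- n - 1) v.
  rewrite /Yz (gcomm_has _ trans_has_par (mode_has_par _ hu)) /=.
  rewrite expr0 scale1r /dz => /eqP; rewrite subr_eq => /eqP.
  rewrite flipK.
  have -> : - (- n - 1 + 1) - 1 = n - 1 by lia.
  have -> : - n - 1 + 1 = - n by lia.
  by rewrite rmorphN scaleNr addrC.
rewrite -(par_sum HV a) !modeD linearD (main _ _ (homog_par false a)).
rewrite (main _ _ (homog_par true a)) scalerDr opprD.
by rewrite addrACA.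
Qed.

(** Covariance gives [T (a_(m+1) vac) = - (m+1) a_(m) vac], so vanishing at [m + 1] passes down to
    [m] as long as [m + 1] is nonzero; it starts where the field is truncated. *)
Lemma mode_vac0 a n : 0 <= n -> mo a n vc = 0.
Proof.
have [N hN] := mode_field HV a vc.
have step m : 0 <= m -> mo a (m + 1) vc = 0 -> mo a m vc = 0.
  move=> m0 h; have := trans_mode a (m + 1) vc.
  rewrite h (trans_vac HV) !linear0 addrK sub0r => /esym/eqP.
  rewrite oppr_eq0 scaler_eq0 intr_eq0 => /orP[/eqP|/eqP //]; lia.
move=> n0; have [m Em] : exists m : nat, N <= n + m%:Z by exists `|N - n|%N; lia.
elim: m n n0 Em => [|m IH] n n0 Em; first by apply: hN; lia.
by apply: step => //; apply: IH; lia.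
Qed.

Lemma vac_modeE n v : mo vc n v = if n == -1 then v else 0.
Proof.
have := vac_mode HV (- n - 1) v; rewrite /Yz.
rewrite flipK.
by move=> ->; congr (if _ then _ else _); apply/eqP/eqP; lia.
Qed.

Definition mode_cut a : V -> int := fun v => sval (cid (mode_field HV a v)).

Lemma mode_cutP a v n : mode_cut a v <= n -> mo a n v = 0.
Proof. exact: (svalP (cid (mode_field HV a v))). Qed.

(** Meant for the difference of two fields with equal values on the vacuum. Every [c] is
    [c_(-1) vac], so [goddard] with [C = Y(c, w)] applies. *)
Lemma vosa_goddard p (E : int -> V -> V) :
  (forall k u v, E k (u + v) = E k u + E k v) ->
  (forall k, E k vc = 0) ->
  (forall q c, homog D q c -> exists N, mlocal ((-1) ^+ (p && q)) E (mo c) N) ->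
  forall k v, E k v = 0.
Proof.
move=> ED Ev loc k v.
have E0 j : E j 0 = 0 by apply: (@addrI _ (E j 0)); rewrite -ED !addr0.
have main q c : homog D q c -> E k c = 0.
  move=> hc; have [N locN] := loc q c hc.
  rewrite -(mode_vac HV c).
  by apply: (goddard Ev _ _ _ locN) => [j|j|j j0]; rewrite ?linear0 ?mode_vac0.
rewrite -(par_sum HV v) ED (main false) ?(main true) ?addr0 //; exact: homog_par.
Qed.

(** For [n < 0], covariance determines [E (n - 1)] from [E n]. With [b = -1]: a covariant field
    creates from the vacuum only what its mode [-1] dictates. *)
Lemma trans_vanish (E : int -> V) (b : int) : b < 0 -> E b = 0 ->
  (forall n, T (E n) = - n%:~R *: E (n - 1)) -> forall n, n <= b -> E n = 0.
Proof.
move=> b0 Eb ET n nb; have [m Em] : exists m : nat, n + m%:Z = b by exists `|b - n|%N; lia.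
elim: m n nb Em => [|m IH] n nb Em; first by rewrite -[n]addr0 Em.
have := ET (n + 1); rewrite IH ?linear0 ?addrK; [|lia|lia].
move/esym/eqP; rewrite scaler_eq0 oppr_eq0 intr_eq0 => /orP[/eqP|/eqP //]; lia.
Qed.

End VosaBasics.

(** * Borcherds' identity in a vertex operator superalgebra *)

Section Borcherds.
Variables (R : realType) (V : lmodType R[i]) (D : vosa_data V).
Hypothesis HV : is_vosa D.
Variables (px py : bool) (x y : V).
Hypotheses (hx : homog D px x) (hy : homog D py y).

Local Notation K := R[i].
Local Notation mo := (mode D).
Local Notation T := (trans D).
Local Notation vc := (vac D).
Local Notation s := ((-1 : K) ^+ (px && py)).

Let xcut v n := @mode_cutP _ _ _ HV x v n.
Let ycut v n := @mode_cutP _ _ _ HV y v n.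
Let coefxy := borcherds_coef s (mo x) (mo y) (mode_cut HV x) (mode_cut HV y).

Lemma mloc_sub (t : K) (A A' C : int -> V -> V) N M :
  (forall k u v, C k (u - v) = C k u - C k v) ->
  mlocal t A C N -> mlocal t A' C M ->
  mlocal t (fun k v => A k v - A' k v) C (maxn N M).
Proof.
move=> CB /(mloc_mono (leq_maxl N M)) h1 /(mloc_mono (leq_maxr N M)) h2 v r k.
rewrite (_ : (fun _ _ => _) = fun r k => (A r (C k v) - t *: C k (A r v)) +
    - (A' r (C k v) - t *: C k (A' r v))); last first.
  apply/funext => i; apply/funext => j.
  by rewrite CB scalerBr !opprD opprK addrACA.
rewrite dif_iterD (@dif_iter_additive _ _ _ -%R).
by rewrite h1 h2 subr0.
Qed.

Lemma trans_borcherds_coef_vac n k :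
  T (coefxy 0 n k vc) = - k%:~R *: coefxy 0 n (k - 1) vc.
Proof.
pose L := (cutoff (mode_cut HV x) (mode_cut HV y) 0 k vc +
  cutoff (mode_cut HV x) (mode_cut HV y) 0 (k - 1) vc)%N.
pose G (l : nat) := mo x (n - l%:Z) (mo y (k - 1 + l%:Z) vc).
have JG k' : (cutoff (mode_cut HV x) (mode_cut HV y) 0 k' vc <= L)%N ->
    coefxy 0 n k' vc =
    \sum_(l < L) sgbin K n l *: mo x (n - l%:Z) (mo y (k' + l%:Z) vc).
  move=> kL; rewrite /coefxy -(borcherds_coef_stable s xcut ycut n kL); apply: eq_bigr => l _.
  by rewrite add0r [mo x (0 + _) _](mode_vac0 HV) ?add0r // linear0 scaler0 subr0.
rewrite !JG; try by rewrite /L; lia.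
(* Moving [T] through both modes leaves, besides the wanted term, the coefficients [l] and [n - l];
   by absorption they combine to [u l.+1 - u l], and [u] vanishes at both ends. *)
pose u l := (l%:R * sgbin K n l) *: G l.
have sgbinS' l : l.+1%:R * sgbin K n l.+1 = - ((n - l%:Z)%:~R * sgbin K n l).
  by rewrite /sgbin mulrCA gbin_absorb exprS; ring.
have uL : u L = 0.
  rewrite /u /G (ycut (v := vc)) ?linear0 ?scaler0 //.
  by rewrite /L /cutoff; lia.
rewrite linear_sum scaler_sumr.
transitivity (\sum_(l < L) (- k%:~R *: (sgbin K n l *: G l)) + (u L - u 0)).
  rewrite -telescope_sumr // big_mkord -big_split; apply: eq_bigr => l _ /=.
  rewrite linearZ /= (trans_mode HV) (trans_mode HV y) (trans_vac HV) linear0 sub0r.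
  rewrite /u sgbinS' /G.
  have -> : n - l.+1%:Z = n - l%:Z - 1 by lia.
  have -> : k - 1 + l.+1%:Z = k + l%:Z by lia.
  have -> : k - 1 + l%:Z = k + l%:Z - 1 by lia.
  rewrite linearN linearZ_LR /=.
  move: (mo x (n - l%:Z) _) (mo x (n - l%:Z - 1) _) => A B.
  move: (sgbin K n l) => b; rewrite scalerBr scalerN ![_ *: (_ *: _)]scalerA.
  rewrite addrCA -[- (_ *: A)]scaleNr -[X in _ = _ + (_ + X)]scaleNr -scalerDl.
  rewrite addrC -[- (_ *: B)]scaleNr.
  by congr (_ *: _ + _ *: _); rewrite ?rmorphD /=; [ring|rewrite -pmulrn; ring].
by rewrite uL /u mul0r scale0r subr0 addr0.
Qed.

(** The case [r = 0], by uniqueness: both fields are covariant on the vacuum, have the same mode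
    [-1] there, and are local with all [Y(c, w)], the left one by Dong's lemma. *)
Lemma iterate n k v : coefxy 0 n k v = mo (mo x n y) k v.
Proof.
apply/eqP; rewrite -subr_eq0; apply/eqP.
apply: (@vosa_goddard _ _ _ HV (px (+) py)
   (fun k v => coefxy 0 n k v - mo (mo x n y) k v)) => [j u w|j|q c hc].
- have := borcherds_coef_linear s xcut ycut 0 n j 1 u w; rewrite !scale1r => e.
  by rewrite /coefxy e linearD opprD addrACA.
- pose E j := coefxy 0 n j vc - mo (mo x n y) j vc.
  have Epos i : 0 <= i -> E i = 0.
    move=> i0; rewrite /E (mode_vac0 HV) // subr0 /coefxy /borcherds_coef /borcherds_partial big1 // => l _.
    rewrite [mo y (i + _) _](mode_vac0 HV); last by lia.
    by rewrite [mo x (0 + _) _](mode_vac0 HV) ?add0r // !linear0 addr0 linear0.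
  have E1 : E (-1) = 0.
    rewrite /E (mode_vac HV) /coefxy -(borcherds_coef_stable s xcut ycut (L := (cutoff (mode_cut HV x) (mode_cut HV y) 0 (-1) vc).+1)) //.
    rewrite /borcherds_partial big_ord_recl big1 => [|l _].
      rewrite /= sgbin0 scale1r !addr0 add0r ?subr0 (mode_vac HV).
      by rewrite [mo x 0 _](mode_vac0 HV) // !linear0 addr0 subrr.
    rewrite lift0 [mo y (-1 + _) _](mode_vac0 HV); last by lia.
    by rewrite [mo x (0 + _) _](mode_vac0 HV) ?add0r // !linear0 addr0 linear0.
  have [j0|j0] := leP 0 j; first exact: Epos.
  apply: (@trans_vanish _ _ D E (-1)) => // i.
  rewrite /E (linearB T) trans_borcherds_coef_vac (trans_mode HV) (trans_vac HV) linear0 sub0r.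
  by rewrite -scaleNr scalerBr.
- have [N1 h1] := mode_mloc HV hx hy.
  have [N2 h2] := mode_mloc HV hx hc.
  have [N3 h3] := mode_mloc HV hy hc.
  pose N := (N1 + N2 + N3)%N.
  have [M hM] := @dong _ _ _ _ (mo c) _ _ xcut ycut _ _ _ N
    (mloc_mono (ltac:(rewrite /N; lia) : (N1 <= N)%N) h1)
    (mloc_mono (ltac:(rewrite /N; lia) : (N2 <= N)%N) h2)
    (mloc_mono (ltac:(rewrite /N; lia) : (N3 <= N)%N) h3) n.
  have hxy : homog D (px (+) py) (mo x n y) by exact: (mode_parity HV).
  have [M' hM'] := mode_mloc HV hxy hc.
  exists (maxn M M'); apply: mloc_sub => //; first by move=> *; exact: linearB.
  rewrite (_ : (-1) ^+ _ = (-1) ^+ (px && q) * (-1) ^+ (py && q) :> K) //.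
  by case: (px) (py) (q) => [] [] []; rewrite /= ?expr0 ?expr1 ?mulr1 ?mul1r ?mulrNN ?mulr1.
Qed.

Definition iterate_sum (I : nat) r n k v : V :=
  \sum_(i < I) gbin K r i *: mo (mo x (n + i%:Z) y) (r + k - i%:Z) v.

Let rcut n : nat := `|mode_cut HV x y - n|%N.

Lemma iterate_sum_stable n I r k v :
  (rcut n <= I)%N -> iterate_sum I r n k v = iterate_sum (rcut n) r n k v.
Proof.
move=> h; apply: (@sum_widen _ _ _ (fun i => gbin K r i *:
  mo (mo x (n + i%:Z) y) (r + k - i%:Z) v)) => // i hi.
by rewrite (xcut (v := y)) ?(mode0 HV) ?scaler0 //; rewrite /rcut in hi; lia.
Qed.

(** The recursion of [borcherds_coef_rec] for the other side of the identity, where it is Pascal's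
    rule; one term is lost. *)
Lemma iterate_sum_rec I r n k v :
  iterate_sum I.+1 (r + 1) n k v - iterate_sum I.+1 r n (k + 1) v = iterate_sum I r (n + 1) k v.
Proof.
rewrite /iterate_sum -sumrB big_ord_recl [X in X + _](_ : _ = 0) ?add0r; last first.
  by rewrite /= !gbin0 [r + 1 + k]addrAC [in X in _ - X]addrA subrr.
apply: eq_bigr => i _; rewrite lift0 gbinS.
have -> : n + i.+1%:Z = n + 1 + i%:Z by lia.
have -> : r + 1 + k - i.+1%:Z = r + k - i%:Z by lia.
have -> : r + (k + 1) - i.+1%:Z = r + k - i%:Z by lia.
by rewrite scalerDl addrAC subrr add0r.
Qed.

(** Descending induction on [n]: for large [n] both sides vanish. If the identity holds at [n + 1],
    the two recursions make the defect [E r k] at [n] a function of [r + k] alone, and it is zero at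
    [r = 0] by [iterate]. *)
Theorem borcherds r n k v : exists L0, forall I L, (L0 <= I)%N -> (L0 <= L)%N ->
  \sum_(i < I) gbin K r i *: mo (mo x (n + i%:Z) y) (r + k - i%:Z) v =
  borcherds_partial s (mo x) (mo y) L r n k v.
Proof.
suff main : iterate_sum (rcut n) r n k v = coefxy r n k v.
  exists (maxn (rcut n) (cutoff (mode_cut HV x) (mode_cut HV y) r k v)) => I L.
  rewrite !geq_max => /andP[I1 _] /andP[_ L2].
  by rewrite -[LHS]/(iterate_sum I r n k v) (iterate_sum_stable _ _ _ I1) main (borcherds_coef_stable s xcut ycut).
have [N h1] := mode_mloc HV hx hy.
have [m Em] : exists m : nat, (maxn N (rcut 0))%:Z <= n + m%:Z by exists `|(maxn N (rcut 0))%:Z - n|%N; lia.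
elim: m n r k Em => [|m IH] n r k Em.
  rewrite /coefxy (borcherds_coef_loc xcut ycut h1); last by lia.
  apply: big1 => i _; rewrite (xcut (v := y)) ?(mode0 HV) ?scaler0 //.
  by move: Em; rewrite /rcut; lia.
pose E r k := iterate_sum (rcut n) r n k v - coefxy r n k v.
have Erec r' k' : E (r' + 1) k' = E r' (k' + 1).
  apply/eqP; rewrite -subr_eq0; apply/eqP.
  have := IH (n + 1) r' k'.
  rewrite -[coefxy r' (n + 1) k' v]/(borcherds_coef _ _ _ _ _ _ _ _ _) -(borcherds_coef_rec s xcut ycut).
  move=> /(_ ltac:(lia)).
  set I := maxn (rcut n) (rcut (n + 1)).
  rewrite -(@iterate_sum_stable (n + 1) I) ?leq_maxr // -iterate_sum_rec.
  rewrite !(@iterate_sum_stable n I.+1) ?(leqW (leq_maxl _ _)) // => /eqP.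
  rewrite -subr_eq0 => /eqP e.
  by rewrite -[RHS]e /E /coefxy !opprD addrACA.
have E0 k' : E 0 k' = 0.
  rewrite /E iterate -(@iterate_sum_stable n (rcut n).+1) // /iterate_sum big_ord_recl big1 => [|i _].
    by rewrite /= gbin0 scale1r !addr0 add0r ?subr0 subrr.
  by rewrite lift0 gbin_nat bin0n scale0r.
have Er (j : nat) : (forall k', E j%:Z k' = 0) /\ (forall k', E (- j%:Z) k' = 0).
  elim: j => [|j [IH1 IH2]]; first by split=> k'; rewrite ?oppr0 E0.
  split=> k'; first by rewrite -addn1 PoszD Erec IH1.
  rewrite -(subrK 1 k') -Erec; have -> : - j.+1%:Z + 1 = - j%:Z by lia.
  exact: IH2.
apply/eqP; rewrite -subr_eq0; apply/eqP; rewrite -/(E r k).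
by case: (intP r) => [|j|j]; [exact: E0|exact: (Er j.+1).1|exact: (Er j.+1).2].
Qed.

End Borcherds.

(** * Weights and commutation with L_1 *)

Lemma borcherds_partial0 (K : numFieldType) (V : lmodType K) (s : K) (x y : int -> {linear V -> V})
    (L : nat) r k v : (0 < L)%N ->
  borcherds_partial s x y L r 0 k v = x r (y k v) - s *: y k (x r v).
Proof.
case: L => // L _; rewrite /borcherds_partial big_ord_recl big1 => [|l _].
  by rewrite /= sgbin0 scale1r ?subr0 !addr0 add0r expr0z mulr1.
by rewrite /sgbin lift0 gbin_nat bin0n mulr0 scale0r.
Qed.

Section VosaWeights.
Variables (R : realType) (V : lmodType R[i]) (D : vosa_data V).
Hypothesis HV : is_vosa D.

Local Notation K := R[i].
Local Notation mo := (mode D).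
Local Notation T := (trans D).
Local Notation vc := (vac D).
Local Notation LL := (L D).
Local Notation wt := (wt_space D).

Lemma commutator px py x y r k v : homog D px x -> homog D py y ->
  exists L0, forall I, (L0 <= I)%N ->
  \sum_(i < I) gbin K r i *: mo (mo x i%:Z y) (r + k - i%:Z) v =
  mo x r (mo y k v) - (-1) ^+ (px && py) *: mo y k (mo x r v).
Proof.
move=> hx hy; have [L0 H] := borcherds HV hx hy r 0 k v.
exists L0 => I hI; have := H I L0.+1 hI (leqnSn _).
rewrite borcherds_partial0 // => <-; apply: eq_bigr => i _; by rewrite add0r.
Qed.

(** The cases [m = 0, 1, 2] give the commutators of [T], [L 0] and [L 1] with modes. No sign appears
    because the conformal vector is even. *)
Lemma conf_commutator (m : nat) a k v : (m < 3)%N ->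
  \sum_(i < 3) 'C(m, i)%:R *: mo (mo (conf D) i%:Z a) (m%:Z + k - i%:Z) v =
  mo (conf D) m%:Z (mo a k v) - mo a k (mo (conf D) m%:Z v).
Proof.
move=> m3.
have main p u : homog D p u ->
    \sum_(i < 3) 'C(m, i)%:R *: mo (mo (conf D) i%:Z u) (m%:Z + k - i%:Z) v =
    mo (conf D) m%:Z (mo u k v) - mo u k (mo (conf D) m%:Z v).
  move=> hu; have [L0 H] := commutator m%:Z k v (conf_even HV) hu.
  have := H (L0 + 3)%N (leq_addr _ _); rewrite /= expr0 scale1r => <-.
  pose F i := gbin K m i *: mo (mo (conf D) i%:Z u) (m%:Z + k - i%:Z) v.
  rewrite [RHS](@sum_widen _ 3 (L0 + 3) F) ?leq_addl //.
    by apply: eq_bigr => i _; rewrite /F gbin_nat.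
  by move=> i hi; rewrite /F gbin_nat bin_small ?scale0r //; exact: leq_trans hi.
rewrite -(par_sum HV a) !(modeD HV) (linearD (mo (conf D) m%:Z)).
rewrite opprD addrACA -!(main _ _ (homog_par HV _ _)) -big_split.
by apply: eq_bigr => i _ /=; rewrite -scalerDr (linearD (mo (conf D) i%:Z)) (modeD HV).
Qed.

Lemma LN1 v : LL (-1) v = T v. Proof. exact: (L_trans HV). Qed.

Lemma conf0 v : mo (conf D) 0 v = T v.
Proof. by rewrite -LN1 /L addNr. Qed.

Lemma mode_trans a n v : mo (T a) n v = - n%:~R *: mo a (n - 1) v.
Proof.
have := @conf_commutator 0 a n v isT.
rewrite big_ord_recl big1 => [|i _]; last by rewrite lift0 bin0n scale0r.
rewrite /= bin0 scale1r addr0 add0r ?subr0 !conf0 => ->.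
by rewrite (trans_mode HV) addrAC subrr add0r scaleNr.
Qed.

Lemma L0_mode h a n v : wt h a ->
  LL 0 (mo a n v) = mo a n (LL 0 v) + (h%:~R / 2 - n%:~R - 1) *: mo a n v.
Proof.
move=> ha; have := @conf_commutator 1 a n v isT.
rewrite !big_ord_recl big_ord0 /= !bin0 bin1 scale1r /bump /= bin_small // scale0r !addr0.
rewrite conf0 mode_trans.
have -> : mo (conf D) 1%:Z a = LL 0 a by rewrite /L add0r.
rewrite ha (modeZ HV) scale1r /LL add0r => /eqP; rewrite eq_sym subr_eq => /eqP ->.
rewrite addrC; congr (_ + _).
have -> : 1%:Z + n - (1 + 0)%N%:Z = n by lia.
rewrite -scalerDl; congr (_ *: _); rewrite rmorphD /=; ring.
Qed.

Lemma L1_mode h a n v : wt h a ->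
  LL 1 (mo a n v) =
  mo a n (LL 1 v) + mo (LL 1 a) n v + (h - n - 2)%:~R *: mo a (n + 1) v.
Proof.
move=> ha; have := @conf_commutator 2 a n v isT.
rewrite !big_ord_recl big_ord0 /= /bump /= !bin0 bin1 binn !scale1r addr0.
rewrite conf0 mode_trans.
have -> : mo (conf D) (1 + 0)%N%:Z a = LL 0 a by rewrite /L add0r.
have -> : mo (conf D) (1 + (1 + 0))%N%:Z a = LL 1 a by rewrite /L.
rewrite ha (modeZ HV) scalerA /LL => /eqP; rewrite eq_sym subr_eq => /eqP ->.
have -> : 2%:Z + n - 1 = n + 1 by lia.
have -> : 2%:Z + n - (1 + (1 + 0))%N%:Z = n by lia.
rewrite addr0 addrA -scalerDl -addrA addrC [X in X + _ = _]addrC.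
congr (_ + _ *: _).
by rewrite !rmorphB rmorphD /= mulrC divfK ?pnatr_eq0 //; ring.
Qed.

Lemma L_linear n x u v : LL n (x *: u + v) = x *: LL n u + LL n v.
Proof. by rewrite /L linearP. Qed.

Lemma L_additive n u v : LL n (u + v) = LL n u + LL n v.
Proof. by rewrite /L linearD. Qed.

Lemma L_scale n x u : LL n (x *: u) = x *: LL n u.
Proof. by rewrite /L linearZ. Qed.

Lemma L_zero n : LL n 0 = 0.
Proof. by rewrite /L linear0. Qed.

Lemma wt_mode h g a b n : wt h a -> wt g b -> wt (h + g - 2 * n - 2) (mo a n b).
Proof.
move=> ha hb; rewrite /wt_space /= (L0_mode _ _ ha) hb linearZ /= -scalerDl.
congr (_ *: _); rewrite !rmorphB rmorphD rmorphM /=.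
have n2 : (2 : K) != 0 by rewrite pnatr_eq0.
by field.
Qed.

Lemma wt_add h a b : wt h a -> wt h b -> wt h (a + b).
Proof. by rewrite /wt_space /= L_additive scalerDr => -> ->. Qed.

Lemma wt_scale h x a : wt h a -> wt h (x *: a).
Proof. by rewrite /wt_space /= L_scale => ->; rewrite !scalerA mulrC. Qed.

Lemma wt0 h : wt h 0.
Proof. by rewrite /wt_space /= L_zero scaler0. Qed.

Lemma L_vac n : -1 <= n -> LL n vc = 0.
Proof. by move=> hn; rewrite /L (mode_vac0 HV) //; lia. Qed.

Lemma wt_vac : wt 0 vc.
Proof. by rewrite /wt_space /= L_vac // mul0r scale0r. Qed.

Lemma wt_L h n a : wt h a -> wt (h - 2 * n) (LL n a).
Proof.
move=> ha; have [c /(_ 0 n a)] := conf_vir HV.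
rewrite expr0n subrr mulr0 scale0r if_same addr0 sub0r add0r => /eqP.
rewrite subr_eq ha L_scale -scalerDl => /eqP; rewrite /wt_space /= => ->.
congr (_ *: _); rewrite rmorphB rmorphM rmorphN /=.
have n2 : (2 : K) != 0 by rewrite pnatr_eq0.
by field.
Qed.

(** For [m] among [-1], [0], [1] the central term drops out. *)
Lemma L_virasoro1 m n v : (m ^+ 3 - m) = 0 ->
  LL m (LL n v) = LL n (LL m v) + (m - n)%:~R *: LL (m + n) v.
Proof.
move=> m0; have [c /(_ m n v)] := conf_vir HV.
rewrite m0 mulr0 scale0r if_same addr0 => /eqP.
by rewrite subr_eq addrC => /eqP.
Qed.

Lemma conf_L : conf D = LL (-2) vc.
Proof. by rewrite -[LHS](mode_vac HV). Qed.

Lemma wt_conf : wt 4 (conf D).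
Proof. by rewrite conf_L; have := wt_L (-2) wt_vac. Qed.

Lemma L1_conf : LL 1 (conf D) = 0.
Proof. by rewrite conf_L L_virasoro1 // !L_vac // L_zero scaler0 addr0. Qed.

Lemma iter_L_linear n j x u v :
  iter j (LL n) (x *: u + v) = x *: iter j (LL n) u + iter j (LL n) v.
Proof. by elim: j => //= j ->; rewrite L_linear. Qed.

Lemma wt_iter_L1 h j a : wt h a -> wt (h - 2 * j%:Z) (iter j (LL 1) a).
Proof.
move=> ha; elim: j => [|j IH] /=; first by rewrite mulr0 subr0.
by have := wt_L 1 IH; congr (wt_space _ _ _); lia.
Qed.

(** [L 1] lowers doubled weights by 2 and these are bounded below. The exponent depends on the
    weight only. *)
Lemma iter_L1_eq0 h :
  exists J, forall j a, wt h a -> (J <= j)%N -> iter j (LL 1) a = 0.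
Proof.
have [K0 hK] := wt_bounded HV; exists (`|h - K0|%N.+1) => j a ha hj.
have := wt_iter_L1 j ha; rewrite hK //; lia.
Qed.

End VosaWeights.

Lemma fsum_seq (I : choiceType) (W : nmodType) (r : seq I) (F : I -> W) :
  uniq r -> (forall i, i \notin r -> F i = 0) ->
  \sum_(i \in [set: I]) F i = \sum_(i <- r) F i.
Proof.
move=> ur F0; rewrite (fsbigE r) // => [|i _ ir]; last exact: F0.
by apply: eq_bigl => i; rewrite mem_set.
Qed.

(** * Weight components and the opposite field *)

Section WeightDecomposition.
Variables (R : realType) (V : lmodType R[i]) (D : vosa_data V).
Hypothesis HV : is_vosa D.

Local Notation K := R[i].
Local Notation mo := (mode D).
Local Notation LL := (L D).
Local Notation wt := (wt_space D).

Lemma wt_decompP a h : wt_decomp D a h <-> (forall k, wt k (h k)) /\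
  exists r, [/\ uniq r, forall k, k \notin r -> h k = 0 & a = \sum_(k <- r) h k].
Proof.
split=> [[fin hw ->]|[hw [r [ur h0 ->]]]].
  have /finite_seqP[r er] := fin; split=> //; exists (undup r).
  have h0 k : k \notin undup r -> h k = 0.
    rewrite mem_undup => kr; apply/eqP/negP => /negP hk; move/negP: kr; apply.
    by have : [set k | h k != 0] k by []; rewrite er.
  by split; [exact: undup_uniq|exact: h0|rewrite (fsum_seq _ h0) ?undup_uniq].
split=> //; last by rewrite (fsum_seq ur h0).
apply: (@sub_finite_set _ _ [set` r]); last exact: finite_seq.
by move=> k /=; apply: contraNT => /h0 ->.
Qed.

Lemma wt_decomp_hom h a : wt h a -> wt_decomp D a (fun k => if k == h then a else 0).
Proof.
move=> ha; apply/wt_decompP; split=> [k|].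
  by case: eqP => [->|_] //; exact: (wt0 D k).
exists [:: h]; split=> //; last by rewrite big_seq1 eqxx.
by move=> k; rewrite inE => /negbTE ->.
Qed.

Lemma wt_homog h a : wt h a -> homog D (odd `|h|%N) a.
Proof.
move=> ha; apply/(parity_wt HV); exists (fun k => if k == h then a else 0).
  exact: wt_decomp_hom.
by move=> k; case: (k =P h) => // ->; rewrite eqxx.
Qed.

Lemma wt_decompD a b h g : wt_decomp D a h -> wt_decomp D b g ->
  wt_decomp D (a + b) (fun k => h k + g k).
Proof.
move=> /wt_decompP[wh [r [ur hr ea]]] /wt_decompP[wg [s [us gs eb]]].
apply/wt_decompP; split=> [k|]; first exact: wt_add.
exists (undup (r ++ s)); split; first exact: undup_uniq.
  by move=> k; rewrite mem_undup mem_cat negb_or => /andP[/hr -> /gs ->]; rewrite addr0.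
rewrite big_split /= ea eb -(fsum_seq ur hr) -(fsum_seq us gs).
congr (_ + _); apply: fsum_seq; rewrite ?undup_uniq // => k;
  by rewrite mem_undup mem_cat negb_or => /andP[kr ks]; rewrite ?hr ?gs.
Qed.

Lemma wt_decompZ x a h : wt_decomp D a h -> wt_decomp D (x *: a) (fun k => x *: h k).
Proof.
move=> /wt_decompP[wh [r [ur hr ->]]]; apply/wt_decompP; split=> [k|].
  exact: wt_scale.
by exists r; split; [|move=> k /hr ->; rewrite scaler0|rewrite scaler_sumr].
Qed.

Lemma wt_decomp_ex a : exists h, wt_decomp D a h.
Proof.
have hp p : exists h, wt_decomp D (par D p a) h.
  by have [h dh _] := (parity_wt HV p (par D p a)).1 (homog_par HV p a); exists h.
have [h dh] := hp false; have [g dg] := hp true.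
by exists (fun k => h k + g k); rewrite -(par_sum HV a); exact: wt_decompD.
Qed.

Lemma wt_ind (P : V -> Prop) : P 0 -> (forall a b, P a -> P b -> P (a + b)) ->
  (forall h a, wt h a -> P a) -> forall a, P a.
Proof.
move=> P0 PD Pw a; have [h /wt_decompP[wh [r [_ _ ->]]]] := wt_decomp_ex a.
by elim/big_ind: _ => // k _; exact: Pw (wh k).
Qed.

(** Eigenvectors for distinct eigenvalues: applying [L 0 - k0 / 2] removes the term at [k0] and
    rescales the others by nonzero factors. *)
Lemma wt_independent r (h : int -> V) : uniq r -> (forall k, wt k (h k)) ->
  \sum_(k <- r) h k = 0 -> forall k, k \in r -> h k = 0.
Proof.
elim: r h => [|k0 r IH] h //= /andP[k0r ur] wh; rewrite big_cons => e.
have n2 : (2 : K) != 0 by rewrite pnatr_eq0.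
have hr k : k \in r -> h k = 0.
  move=> kr; have : ((k - k0)%:~R / 2 : K) *: h k = 0.
    apply: (IH (fun k => ((k - k0)%:~R / 2 : K) *: h k)) => // [k'|].
      exact: wt_scale.
    have : LL 0 (h k0 + \sum_(j <- r) h j) = 0 by rewrite e L_zero.
    rewrite L_additive wh.
    have -> : LL 0 (\sum_(j <- r) h j) = \sum_(j <- r) (j%:~R / 2 : K) *: h j.
      by rewrite /L linear_sum; apply: eq_bigr => j _; exact: wh.
    move=> e0; transitivity
        (\sum_(j <- r) ((j%:~R / 2 : K) *: h j - (k0%:~R / 2 : K) *: h j)).
      by apply: eq_bigr => j _; rewrite rmorphB /= mulrBl scalerBl.
    rewrite sumrB -scaler_sumr; move/eqP: e; rewrite addrC addr_eq0 => /eqP ->.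
    by rewrite scalerN opprK addrC.
  move/eqP; rewrite scaler_eq0 mulf_eq0 invr_eq0 (negbTE n2) orbF intr_eq0 subr_eq0.
  by case/orP=> [/eqP kk0|/eqP //]; rewrite -kk0 kr in k0r.
move=> k; rewrite inE => /orP[/eqP ->|/hr //].
by move: e; rewrite big_seq big1 ?addr0.
Qed.

Lemma wt_decomp_uniq a h g : wt_decomp D a h -> wt_decomp D a g -> h =1 g.
Proof.
move=> dh /(wt_decompZ (-1)) /(wt_decompD dh).
rewrite scaleN1r subrr => /wt_decompP[w [r [ur hr /esym e]]] k.
have : h k + -1 *: g k = 0.
  by have [kr|/hr //] := boolP (k \in r); exact: (wt_independent ur w e kr).
by rewrite scaleN1r => /eqP; rewrite subr_eq0 => /eqP.
Qed.

Lemma wt_projE a h k : wt_decomp D a h -> wt_proj D k a = h k.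
Proof.
move=> dh; rewrite /wt_proj; case: xgetP => [b _ [g dg ->]|/(_ (h k))].
  exact: wt_decomp_uniq dg dh _.
by case; exists h.
Qed.

Lemma wt_projD k a b : wt_proj D k (a + b) = wt_proj D k a + wt_proj D k b.
Proof.
have [h dh] := wt_decomp_ex a; have [g dg] := wt_decomp_ex b.
by rewrite (wt_projE _ dh) (wt_projE _ dg) (wt_projE _ (wt_decompD dh dg)).
Qed.

Lemma wt_projZ k x a : wt_proj D k (x *: a) = x *: wt_proj D k a.
Proof.
have [h dh] := wt_decomp_ex a.
by rewrite (wt_projE _ dh) (wt_projE _ (wt_decompZ x dh)).
Qed.

Lemma wt_proj_hom k h a : wt h a -> wt_proj D k a = if k == h then a else 0.
Proof. by move=> ha; rewrite (wt_projE k (wt_decomp_hom ha)). Qed.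

Lemma wt_proj_supp a : exists r : seq int, forall k, k \notin r -> wt_proj D k a = 0.
Proof.
have [h dh] := wt_decomp_ex a; have /wt_decompP[_ [r [_ hr _]]] := dh.
by exists r => k /hr; rewrite (wt_projE _ dh).
Qed.

Lemma iter_L1_0 j : iter j (LL 1) 0 = 0.
Proof. by elim: j => //= j ->; exact: L_zero. Qed.

(** Stated for all lists containing [r], so that the twists of several vectors can be summed over a
    common list. *)
Lemma twist_seq a m : exists r : seq nat, forall s, uniq s -> {subset r <= s} ->
  twist D a m = \sum_(j <- s) ((j`!)%:R^-1 * (-1) ^ ((j%:Z - m) * (j%:Z - m + 1) %/ 2)%Z) *:
      iter j (LL 1) (wt_proj D (j%:Z - m) a).
Proof.
have [r hr] := wt_proj_supp a; exists [seq absz (k + m) | k <- r] => s us sub.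
apply: fsum_seq => // j js; rewrite /= hr ?iter_L1_0 ?scaler0 //.
apply: contra js => jr; apply: sub; apply/mapP; exists (j%:Z - m) => //.
by rewrite subrK.
Qed.

Lemma twist_linear x a b m : twist D (x *: a + b) m = x *: twist D a m + twist D b m.
Proof.
have [r1 h1] := twist_seq a m; have [r2 h2] := twist_seq b m.
have [r3 h3] := twist_seq (x *: a + b) m.
pose s := undup (r1 ++ r2 ++ r3).
have us : uniq s by exact: undup_uniq.
rewrite (h1 s) ?(h2 s) ?(h3 s) //; last first.
- by move=> j; rewrite mem_undup !mem_cat => ->.
- by move=> j; rewrite mem_undup !mem_cat => ->; rewrite orbT.
- by move=> j; rewrite mem_undup !mem_cat => ->; rewrite !orbT.
rewrite scaler_sumr -big_split; apply: eq_bigr => j _ /=.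
by rewrite wt_projD wt_projZ iter_L_linear scalerDr !scalerA [_ * x]mulrC.
Qed.

(** The eigenvalue of [(-1)^(2 L_0^2 + L_0)] in doubled weight [h]. *)
Definition wt_sign (h : int) : K := (-1) ^ (h * (h + 1) %/ 2)%Z.

Definition L1_div (j : nat) (a : V) : V := (j`!)%:R^-1 *: iter j (LL 1) a.

Lemma twist_hom h a m : wt h a ->
  twist D a m = if 0 <= m + h then wt_sign h *: L1_div (absz (m + h)) a else 0.
Proof.
move=> ha; have [r hr] := twist_seq a m.
rewrite (hr (undup ((absz (m + h)) :: r))) ?undup_uniq //; last first.
  by move=> j jr; rewrite mem_undup inE jr orbT.
have term0 j : j%:Z - m != h -> iter j (LL 1) (wt_proj D (j%:Z - m) a) = 0.
  move=> jh; rewrite (wt_proj_hom _ ha) (negbTE jh).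
  by elim: j {jh} => //= j ->; exact: L_zero.
case: ifPn => mh.
  rewrite (bigD1_seq (absz (m + h))) ?undup_uniq ?mem_undup ?inE ?eqxx //=.
  rewrite [X in _ + X]big1 ?addr0 => [|j jm]; last first.
    by rewrite term0 ?scaler0 //; apply: contra jm => /eqP; lia.
  have -> : (absz (m + h))%:Z - m = h by lia.
  by rewrite (wt_proj_hom _ ha) eqxx /L1_div scalerA mulrC.
by apply: big1 => j _; rewrite term0 ?scaler0 //; lia.
Qed.

Lemma twist_supp a : exists r : seq int, forall m, m \notin r -> twist D a m = 0.
Proof.
elim/wt_ind: a => [|a b [r1 h1] [r2 h2]|h a ha].
- exists [::] => m _; rewrite (twist_hom m (wt0 D 0)); case: ifP => // _.
  by rewrite /L1_div iter_L1_0 !scaler0.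
- exists (r1 ++ r2) => m; rewrite mem_cat negb_or => /andP[/h1 e1 /h2 e2].
  by have := twist_linear 1 a b m; rewrite !scale1r e1 e2 addr0.
- have [J hJ] := iter_L1_eq0 HV h.
  exists [seq j%:Z - h | j <- iota 0 J] => m mr; rewrite (twist_hom m ha).
  case: ifP => // mh; rewrite /L1_div (hJ _ _ ha) ?scaler0 //.
  rewrite leqNgt; apply: contra mr => jJ; apply/mapP; exists (absz (m + h)); last by lia.
  by rewrite mem_iota add0n.
Qed.

(** The list depends neither on [k] nor on [c]: the opposite field is one finite combination of
    shifted fields. *)
Lemma Yinv_seq a : exists r : seq int, forall s, uniq s -> {subset r <= s} ->
  forall k c, Yinv D (twist D a) k c = \sum_(m <- s) Yz D (twist D a m) (m - k) c.
Proof.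
have [r hr] := twist_supp a; exists r => s us sub k c; apply: fsum_seq => // m ms.
rewrite hr; first by rewrite /Yz (mode0 HV).
by apply: contra ms => /sub.
Qed.

Lemma Yinv_linear x a b k c : Yinv D (twist D (x *: a + b)) k c =
  x *: Yinv D (twist D a) k c + Yinv D (twist D b) k c.
Proof.
have [r1 h1] := Yinv_seq a; have [r2 h2] := Yinv_seq b.
have [r3 h3] := Yinv_seq (x *: a + b).
pose s := undup (r1 ++ r2 ++ r3).
have us : uniq s by exact: undup_uniq.
rewrite (h1 s) ?(h2 s) ?(h3 s) //; last first.
- by move=> j; rewrite mem_undup !mem_cat => ->.
- by move=> j; rewrite mem_undup !mem_cat => ->; rewrite orbT.
- by move=> j; rewrite mem_undup !mem_cat => ->; rewrite !orbT.
rewrite scaler_sumr -big_split; apply: eq_bigr => j _ /=.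
by rewrite twist_linear /Yz (mode_linear HV).
Qed.

(* The modes of [Y(e^(z L_1) (-1)^(2 L_0^2 + L_0) z^(-2 L_0) a, z^-1)]
   for [a] of doubled weight [h]; the sum over [j < J] is complete as soon as
   [L_1^J a = 0]. *)
Definition opp_mode (h : int) (a : V) (J : nat) (n : int) (c : V) : V :=
  wt_sign h *: \sum_(j < J) mo (L1_div j a) (h - n - 2 - j%:Z) c.

Lemma Yinv_hom h a J : wt h a -> (forall j, (J <= j)%N -> iter j (LL 1) a = 0) ->
  forall n c, Yinv D (twist D a) (- n - 1) c = opp_mode h a J n c.
Proof.
move=> ha hJ n c; have [r hr] := Yinv_seq a.
pose s := [seq j%:Z - h | j <- iota 0 J].
have us : uniq s by rewrite map_inj_uniq ?iota_uniq // => i j /addIr [].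
rewrite /Yinv (fsum_seq us) => [|m ms].
  rewrite /s big_map /opp_mode scaler_sumr -(big_mkord xpredT (fun j => wt_sign h *:  mo (L1_div j a) (h - n - 2 - j%:Z) c)).
  rewrite /index_iota subn0; apply: eq_bigr => j _; rewrite (twist_hom _ ha) subrK /=.
  by rewrite /Yz (modeZ HV); congr (_ *: mo _ _ _); lia.
rewrite (twist_hom m ha); case: ifP => mh; rewrite /Yz ?(mode0 HV) //.
rewrite /L1_div hJ ?scaler0 ?(mode0 HV) //.
rewrite leqNgt; apply: contra ms => jJ; apply/mapP; exists (absz (m + h)); last by lia.
by rewrite mem_iota add0n.
Qed.

End WeightDecomposition.

(** * From an antilinear automorphism to local adjoints *)

Section SignLemmas.
Variable R : realType.
Local Notation K := R[i].
Implicit Types h g n t : int.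

Lemma signzD n t : (-1 : K) ^ (n + t) = (-1) ^ n * (-1) ^ t.
Proof. by rewrite exprzDr ?unitrN1. Qed.

Lemma signz2 n : (-1 : K) ^ (2 * n) = 1.
Proof. by rewrite -exprz_exp -exprnP sqrrN expr1n exp1rz. Qed.

Lemma signz_sq n : (-1 : K) ^ n * (-1) ^ n = 1.
Proof. by rewrite -signzD -mulr2n -mulr_natl signz2. Qed.

Lemma signzN n : (-1 : K) ^ (- n) = (-1) ^ n.
Proof.
have := signz_sq n; have := signzD (- n) n; rewrite addNr expr0z.
move: (_ ^ (- n)) (_ ^ n) => a b ab bb.
by rewrite -[a]mulr1 -bb mulrA -ab mul1r.
Qed.

(** A witness [t] for the half of [h (h + 1)] removes the integer division, so that sign identities
    reduce to polynomial ones. *)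
Lemma wt_sign_half h t : h * (h + 1) = 2 * t -> wt_sign R h = (-1) ^ t.
Proof. by rewrite /wt_sign => ->; rewrite mulKz. Qed.

Lemma half_pronic h : exists t, h * (h + 1) = 2 * t.
Proof.
have [m [e|e]] : exists m, h = 2 * m \/ h = 2 * m + 1.
  exists (h %/ 2)%Z; have := divz_eq h 2; have := modz_ge0 h (isT : 2 != 0 :> int).
  have := ltz_pmod h (isT : 0 < 2 :> int); lia.
- by exists (m * (h + 1)); rewrite {1}e; ring.
- by exists ((2 * m + 1) * (m + 1)); rewrite e; ring.
Qed.

Lemma wt_sign_sq h : wt_sign R h * wt_sign R h = 1.
Proof. by have [t /wt_sign_half ->] := half_pronic h; exact: signz_sq. Qed.

Lemma wt_sign_sub h n : wt_sign R (h - 2 * n) = (-1) ^ n * wt_sign R h.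
Proof.
have [t e] := half_pronic h; rewrite (wt_sign_half e).
rewrite (@wt_sign_half _ (n + (t + 2 * (n ^+ 2 - n - h * n)))).
  by rewrite !signzD signz2 mulr1.
by rewrite !mulrDr -e; ring.
Qed.

(** The cross term [h g] of the quadratic exponent is, by [signz_mul], the sign for exchanging
    vectors of doubled weights [h] and [g]. *)
Lemma wt_sign_add h g :
  wt_sign R (h + g) = (-1) ^ (h * g) * (wt_sign R h * wt_sign R g).
Proof.
have [t e] := half_pronic h; have [u e'] := half_pronic g.
rewrite (wt_sign_half e) (wt_sign_half e') -!signzD; apply: wt_sign_half.
by rewrite !mulrDr -e -e'; ring.
Qed.

Lemma signz_odd n : (-1 : K) ^ n = (-1) ^+ odd `|n|%N.
Proof.
by case: n => n; rewrite ?NegzE ?signzN -exprnP signr_odd // abszN.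
Qed.

Lemma signz_mul h g : (-1 : K) ^ (h * g) = (-1) ^+ (odd `|h|%N && odd `|g|%N).
Proof. by rewrite signz_odd abszM oddM. Qed.

Lemma wt_sign_4 : wt_sign R 4 = 1.
Proof. by rewrite (@wt_sign_half _ 10) // -[10]/(2 * 5 : int) signz2. Qed.

Lemma wt_sign_0 : wt_sign R 0 = 1.
Proof. by rewrite (@wt_sign_half _ 0) // expr0z. Qed.

Lemma conj_wt_sign h : (wt_sign R h)^* = wt_sign R h.
Proof. by rewrite /wt_sign signz_odd rmorph_sign. Qed.

End SignLemmas.

Section LinearCombination.
Variables (K : numFieldType) (V : lmodType K) (I : Type).

(** Packaged as a linear map, since the modes of an adjoint field are required to be of type
    [{linear V -> V}]. *)
Definition lincomb (s : seq I) (c : I -> K) (F : I -> {linear V -> V}) (v : V) : V :=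
  \sum_(i <- s) c i *: F i v.

Lemma lincomb_is_linear s c F : linear (lincomb s c F).
Proof.
move=> x u v; rewrite /lincomb scaler_sumr -big_split; apply: eq_bigr => i _ /=.
by rewrite linearP scalerDr !scalerA mulrC.
Qed.

HB.instance Definition _ s c F :=
  GRing.isLinear.Build K V V *:%R (lincomb s c F) (lincomb_is_linear s c F).

End LinearCombination.

Section Scalar.
Variables (R : realType) (V : lmodType R[i]) (ip : V -> V -> R[i]).
Hypothesis Hip : scalar_product ip.

Lemma ipDr a b c : ip a (b + c) = ip a b + ip a c.
Proof. by have := ip_linear Hip a 1 b c; rewrite scale1r mul1r. Qed.

Lemma ip0r a : ip a 0 = 0.
Proof. by apply: (@addrI _ (ip a 0)); rewrite -ipDr !addr0. Qed.

Lemma ipZr a x b : ip a (x *: b) = x * ip a b.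
Proof. by have := ip_linear Hip a x b 0; rewrite ip0r !addr0. Qed.

Lemma ipBr a b c : ip a (b - c) = ip a b - ip a c.
Proof. by rewrite ipDr -scaleN1r ipZr mulN1r. Qed.

Lemma ipDl a b c : ip (a + b) c = ip a c + ip b c.
Proof. by rewrite !(ip_herm Hip _ c) ipDr rmorphD. Qed.

Lemma ipZl x a b : ip (x *: a) b = x^* * ip a b.
Proof. by rewrite !(ip_herm Hip _ b) ipZr rmorphM. Qed.

Lemma ip0l a : ip 0 a = 0.
Proof. by rewrite (ip_herm Hip) ip0r conjC0. Qed.

Lemma ipBl a b c : ip (a - b) c = ip a c - ip b c.
Proof. by rewrite !(ip_herm Hip _ c) ipBr rmorphB. Qed.

Lemma ip_sumr a (I : Type) (r : seq I) (P : pred I) (F : I -> V) :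
  ip a (\sum_(i <- r | P i) F i) = \sum_(i <- r | P i) ip a (F i).
Proof. by elim/big_rec2: _ => [|i y1 y2 _ <-]; [exact: ip0r|exact: ipDr]. Qed.

Lemma ip_suml a (I : Type) (r : seq I) (P : pred I) (F : I -> V) :
  ip (\sum_(i <- r | P i) F i) a = \sum_(i <- r | P i) ip (F i) a.
Proof. by elim/big_rec2: _ => [|i y1 y2 _ <-]; [exact: ip0l|exact: ipDl]. Qed.

Lemma ip_eq0 a : ip a a = 0 -> a = 0.
Proof. by move=> e; apply/eqP/negP => /negP /(ip_pos Hip); rewrite e ltxx. Qed.

Lemma ip_injl a b : (forall c, ip a c = ip b c) -> a = b.
Proof.
move=> h; apply/eqP; rewrite -subr_eq0; apply/eqP/ip_eq0.
by rewrite ipBl h subrr.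
Qed.

Lemma ip_swap a b c d : ip a b = ip c d -> ip b a = ip d c.
Proof. by rewrite (ip_herm Hip b) (ip_herm Hip d) => ->. Qed.

End Scalar.

Section Locality.
Variables (R : realType) (V : lmodType R[i]) (D : vosa_data V).

Lemma gcommDl (A A' : V -> V) (B : {linear V -> V}) v :
  gcomm D (fun v => A v + A' v) B v = gcomm D A B v + gcomm D A' B v.
Proof.
rewrite /gcomm -big_split; apply: eq_bigr => p _; rewrite -big_split.
apply: eq_bigr => q _ /=.
have opD u : op_par D p (fun v => A v + A' v) u = op_par D p A u + op_par D p A' u.
  by rewrite /op_par -big_split; apply: eq_bigr => q' _; rewrite linearD.
have BD u w : op_par D q B (u + w) = op_par D q B u + op_par D q B w.
  by rewrite /op_par -big_split; apply: eq_bigr => q' _; rewrite !linearD.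
by rewrite !opD BD scalerDr opprD addrACA.
Qed.

Lemma gcomm0l (B : {linear V -> V}) v : gcomm D (fun=> 0) B v = 0.
Proof.
have := gcommDl (fun=> 0) (fun=> 0) B v.
rewrite (_ : (fun=> 0 + 0) = fun=> 0); last by apply/funext => u; rewrite addr0.
by rewrite -[LHS]addr0 => /addrI.
Qed.

Lemma mul_zw_iterD N (F G : distr2 V) k l v :
  iter N (@mul_zw V) (fun i j v => F i j v + G i j v) k l v =
  iter N (@mul_zw V) F k l v + iter N (@mul_zw V) G k l v.
Proof.
elim: N k l => //= N IH k l; rewrite /mul_zw !IH opprD addrACA //.
Qed.

Lemma mul_zw_iter_shift N (F : distr2 V) m k l v :
  iter N (@mul_zw V) (fun i j v => F (i + m) j v) k l v =
  iter N (@mul_zw V) F (k + m) l v.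
Proof. by elim: N k l => //= N IH k l; rewrite /mul_zw !IH addrAC. Qed.

Lemma local_shift A B N m : local_at D A B N -> local_at D (fun k => A (k + m)) B N.
Proof.
move=> H k l v.
by rewrite (@mul_zw_iter_shift N (fun i j => gcomm D (A i) (B j)) m) H.
Qed.

(** Exponents are given as thresholds, so that a maximum serves all the summands at once. *)
Lemma local_sum (I : Type) (s : seq I) (A : I -> distr V) (B : int -> {linear V -> V}) :
  (forall i, exists N0, forall N, (N0 <= N)%N -> local_at D (A i) B N) ->
  exists N0, forall N, (N0 <= N)%N ->
    local_at D (fun k v => \sum_(i <- s) A i k v) B N.
Proof.
move=> H; elim: s => [|i s [N1 h1]].
  exists 0%N => N _ k l v.
  rewrite (_ : (fun _ _ => _) = fun _ _ _ => 0).
    by elim: N k l => //= N IH k l; rewrite /mul_zw !IH subrr.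
  apply/funext => i; apply/funext => j; apply/funext => u.
  rewrite (_ : (fun _ => _) = fun=> 0) ?gcomm0l //.
  by apply/funext => w; rewrite big_nil.
have [N2 h2] := H i; exists (maxn N1 N2) => N; rewrite geq_max => /andP[n1 n2] k l v.
rewrite (_ : (fun _ _ => _) = fun i' j v => gcomm D (A i i') (B j) v +
   gcomm D (fun v => \sum_(i <- s) A i i' v) (B j) v).
  by rewrite mul_zw_iterD (h2 N n2) (h1 N n1) addr0.
apply/funext => i'; apply/funext => j; apply/funext => u; rewrite -gcommDl.
by congr (gcomm D _ _ u); apply/funext => w; rewrite big_cons.
Qed.

End Locality.

Section UnitaryToAdjoint.
Variables (R : realType) (V : lmodType R[i]) (D : vosa_data V) (ip : V -> V -> R[i]).
Hypotheses (HV : is_vosa D) (Hip : scalar_product ip).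
Variable theta : V -> V.
Hypothesis Hth : is_pct D ip theta.

(** The conformal vector is quasi-primary of doubled weight 4 and sign 1, so only the term [j = 0]
    is left, with index [4 - n - 2]. *)
Lemma Yinv_conf n c :
  Yinv D (twist D (conf D)) (- n - 1) c = mode D (conf D) (2 - n) c.
Proof.
rewrite (Yinv_hom HV (wt_conf HV) (J := 1%N)) => [|[|j] // _].
  rewrite /opp_mode big_ord1 wt_sign_4 scale1r /L1_div /= fact0 invr1 scale1r.
  by congr (mode _ _ _ _); lia.
rewrite iterSr (L1_conf HV); exact: iter_L1_0.
Qed.

Lemma pct_mobius : unitary_mobius D ip.
Proof.
move=> a b n _; have := pct_invariance Hth (conf D) a b (- (n + 1) - 1).
rewrite (pct_conf Hth) Yinv_conf /Yz flipK => ->.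
by congr (ip _ (mode _ _ _ _)); lia.
Qed.


Lemma pct_local_adjoint a : has_local_adjoint D ip a.
Proof.
(* Invariance is applied to [theta a]: as [theta] is an involution, it then speaks of the modes of
   [a]. *)
have [r hr] := Yinv_seq HV (theta a); pose s := undup r.
have sub : {subset r <= s} by move=> j; rewrite mem_undup.
have hs := hr s (undup_uniq _) sub.
pose ap n : {linear V -> V} := lincomb s (fun=> 1)
  (fun m => mode D (twist D (theta a) m) (- (m + n + 1) - 1)).
have apE n c : ap n c = Yinv D (twist D (theta a)) (- n - 1) c.
  rewrite hs; apply: eq_bigr => m _; rewrite scale1r /Yz.
  by congr (mode _ _ _ _); lia.
exists ap => [n b c|b].
  have := pct_invariance Hth (theta a) c b (- n - 1).
  by rewrite (pct_inv Hth) /Yz flipK -apE => /(ip_swap Hip).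
have [N h] := @local_sum _ _ D _ s
  (fun m k => Yz D (twist D (theta a) m) (k + m)) (fun k => mode D b (- k - 1))
  (fun m => let: ex_intro N0 H := locality HV (twist D (theta a) m) b in
     ex_intro _ N0 (fun N hN => local_shift m (H N hN))).
exists N; have := h N (leqnn N).
congr (local_at D _ _ N); apply/funext => k; apply/funext => v.
apply: eq_bigr => m _; rewrite scale1r /Yz; congr (mode _ _ _ _); lia.
Qed.

End UnitaryToAdjoint.

(** * From local adjoints to an antilinear automorphism *)

Section DividedPowers.
Variables (R : realType) (V : lmodType R[i]) (D : vosa_data V).
Hypothesis HV : is_vosa D.
Local Notation K := R[i].
Local Notation mo := (mode D).
Local Notation LL := (L D).
Local Notation wt := (wt_space D).
Local Notation dv := (L1_div D).

Lemma dvp0 a : dv 0 a = a.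
Proof. by rewrite /L1_div fact0 invr1 scale1r. Qed.

Lemma L1_dvp j a : LL 1 (dv j a) = j.+1%:R *: dv j.+1 a.
Proof.
rewrite /L1_div L_scale -iterS scalerA; congr (_ *: _).
by rewrite factS natrM invfM mulrA mulfV ?pnatr_eq0 // mul1r.
Qed.

Lemma wt_dvp h j a : wt h a -> wt (h - 2 * j%:Z) (dv j a).
Proof. by move=> ha; apply: wt_scale; exact: wt_iter_L1. Qed.

Lemma dvp_eq0 j a : iter j (LL 1) a = 0 -> dv j a = 0.
Proof. by rewrite /L1_div => ->; rewrite scaler0. Qed.

Definition opp_sum (h : int) (a : V) (J : nat) (n : int) (c : V) : V :=
  \sum_(j < J) mo (dv j a) (h - n - 2 - j%:Z) c.

(** [L 1] acts on the vector [dv j a] and shifts the mode index. The first contribution and the part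
    of the second with coefficient [- j] telescope in [u], and [dv J a = 0] closes the sum. *)
Lemma L1_opp_sum h a J n c : wt h a -> dv J a = 0 ->
  LL 1 (opp_sum h a J n c) = opp_sum h a J n (LL 1 c) + n%:~R *: opp_sum h a J (n - 1) c.
Proof.
move=> ha aJ.
pose W (j : nat) := mo (dv j a) (h - n - 1 - j%:Z) c.
pose u (j : nat) := j%:R *: W j.
have -> : LL 1 (opp_sum h a J n c) = \sum_(j < J) LL 1 (mo (dv j a) (h - n - 2 - j%:Z) c).
  by rewrite /L /opp_sum linear_sum.
rewrite /opp_sum scaler_sumr -big_split /=.
transitivity (\sum_(j < J) (mo (dv j a) (h - n - 2 - j%:Z) (LL 1 c) +
    n%:~R *: mo (dv j a) (h - (n - 1) - 2 - j%:Z) c) + (u J - u 0)); last first.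
  by rewrite /u /W aJ (mode0 HV) scaler0 scale0r subrr addr0.
rewrite -telescope_sumr // big_mkord -big_split; apply: eq_bigr => j _ /=.
rewrite (L1_mode HV _ _ (wt_dvp j ha)) L1_dvp (modeZ HV) /u /W.
have -> : h - n - 1 - j.+1%:Z = h - n - 2 - j%:Z by lia.
have -> : h - (n - 1) - 2 - j%:Z = h - n - 1 - j%:Z by lia.
have -> : h - n - 2 - j%:Z + 1 = h - n - 1 - j%:Z by lia.
have -> : h - 2 * j%:Z - (h - n - 2 - j%:Z) - 2 = n - j%:Z by lia.
rewrite -[LHS]addrA -[RHS]addrA; congr (_ + _).
rewrite [RHS]addrCA; congr (_ + _).
by rewrite rmorphB /= scalerBl -pmulrn.
Qed.

Lemma L0_opp_sum h a J n c : wt h a ->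
  LL 0 (opp_sum h a J n c) =
  opp_sum h a J n (LL 0 c) - (h%:~R / 2 - n%:~R - 1) *: opp_sum h a J n c.
Proof.
move=> ha.
have -> : LL 0 (opp_sum h a J n c) = \sum_(j < J) LL 0 (mo (dv j a) (h - n - 2 - j%:Z) c).
  by rewrite /L /opp_sum linear_sum.
rewrite /opp_sum -scaleNr scaler_sumr -big_split; apply: eq_bigr => j _ /=.
rewrite (L0_mode HV _ _ (wt_dvp j ha)); congr (_ + _ *: _).
rewrite !rmorphB rmorphM /=.
have n2 : (2 : K) != 0 by rewrite pnatr_eq0.
by field.
Qed.

End DividedPowers.

(** * Construction of [theta] from the adjoint fields *)

Section AdjointToUnitary.
Variables (R : realType) (V : lmodType R[i]) (D : vosa_data V) (ip : V -> V -> R[i]).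
Hypotheses (HV : is_vosa D) (Hip : scalar_product ip).
Hypothesis Hmob : unitary_mobius D ip.
Hypothesis Hloc : forall a, has_local_adjoint D ip a.

Local Notation K := R[i].
Local Notation mo := (mode D).
Local Notation T := (trans D).
Local Notation vc := (vac D).
Local Notation LL := (L D).
Local Notation wt := (wt_space D).
Local Notation dv := (L1_div D).

Lemma L1_adj a b : ip (LL 1 a) b = ip a (LL (-1) b).
Proof. exact: Hmob. Qed.

Lemma LN1_adj a b : ip (LL (-1) a) b = ip a (LL 1 b).
Proof. by rewrite Hmob ?opprK. Qed.

Lemma L0_adj a b : ip (LL 0 a) b = ip a (LL 0 b).
Proof. by rewrite Hmob ?oppr0. Qed.

Lemma conj_half h : ((h%:~R / 2 : K)^* ) = h%:~R / 2.
Proof. by rewrite rmorphM fmorphV /= conjC_nat rmorph_int. Qed.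

Lemma wt_orth h g a b : wt h a -> wt g b -> h != g -> ip a b = 0.
Proof.
move=> ha hb hg; have := L0_adj a b; rewrite ha hb (ipZl Hip) (ipZr Hip) conj_half.
move/eqP; rewrite -subr_eq0 -mulrBl mulf_eq0 -mulrBl -rmorphB /= mulf_eq0 invr_eq0.
by rewrite pnatr_eq0 orbF intr_eq0 subr_eq0 (negbTE hg) => /eqP.
Qed.

(** Each parity subspace is a sum of weight spaces, and weights of different parity are different.
    This is what gives adjoints a parity. *)
Lemma homog_orth p q a b : homog D p a -> homog D q b -> p != q -> ip a b = 0.
Proof.
move=> /(parity_wt HV)[h /wt_decompP[wh [r [_ _ ->]]] ph].
move=> /(parity_wt HV)[g /wt_decompP[wg [s [_ _ ->]]] qg] pq.
rewrite (ip_suml Hip); apply: big1 => k _; rewrite (ip_sumr Hip); apply: big1 => l _.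
have [kl|] := eqVneq k l; last exact: wt_orth.
have [kp|kp] := eqVneq (odd `|k|%N) p; last by rewrite ph ?(ip0l Hip).
by rewrite qg ?(ip0r Hip) // -kl kp.
Qed.

(** Induction upwards from the lower bound of the weights. If all lower negative weights vanish then
    [L 1 a = 0], so the square norm of [L (-1) a] is [h] times that of [a], which is negative unless
    [a = 0]. *)
Lemma wt_neg h a : wt h a -> h < 0 -> a = 0.
Proof.
have [K0 hK] := wt_bounded HV.
suff main (m : nat) h' a' : h' < K0 + m%:Z -> wt h' a' -> h' < 0 -> a' = 0.
  by apply: (main `|h - K0|%N.+1); lia.
elim: m h' a' => [|m IH] h' a' hm ha hn; first by move: ha; rewrite hK //; lia.
have L1a : LL 1 a' = 0 by apply: (IH _ _ _ (wt_L HV 1 ha)); lia.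
have e : ip (LL (-1) a') (LL (-1) a') = h'%:~R * ip a' a'.
  rewrite LN1_adj (L_virasoro1 HV) // L1a L_zero add0r addrN ha scalerA (ipZr Hip).
  by congr (_ * _); rewrite opprK mulrC divfK // pnatr_eq0.
apply/eqP/negP => /negP a0; have := ip_pos Hip a0 => pos.
have : ip (LL (-1) a') (LL (-1) a') < 0 by rewrite e nmulr_rlt0 // ltrz0.
have [->|/(ip_pos Hip)] := eqVneq (LL (-1) a') 0; first by rewrite (ip0r Hip) ltxx.
by move=> /lt_trans h1 /h1; rewrite ltxx.
Qed.

Definition adj (x : V) : int -> {linear V -> V} := s2val (cid2 (Hloc x)).

Lemma adjP x n b c : ip b (mo x n c) = ip (adj x n b) c.
Proof. exact: (s2valP (cid2 (Hloc x))). Qed.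

Lemma adj_local x b : exists N, local_at D (fun k => adj x (k - 1)) (Yz D b) N.
Proof. exact: (s2valP' (cid2 (Hloc x))). Qed.

Lemma local_mono A B N M : (N <= M)%N -> local_at D A B N -> local_at D A B M.
Proof.
move=> NM h k l v; rewrite mul_zw_iter; apply: dif_iter_mono NM _ _ _ => r s.
have := h (- r - 1) (- s - 1) v; rewrite mul_zw_iter !flipK.
by [].
Qed.

Section Homogeneous.
Variables (h : int) (a : V) (J : nat).
Hypotheses (ha : wt h a) (hJ : forall j, (J <= j)%N -> iter j (LL 1) a = 0).
Local Notation p := (odd `|h|%N).

(** The adjoint of [opp_sum D h a J n]; up to [wt_sign h] it will be the mode [n] of [theta a]. *)
Definition adjop (n : int) : {linear V -> V} :=
  lincomb (iota 0 J) (fun=> 1) (fun j => adj (dv j a) (h - n - 2 - j%:Z)).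

Lemma adjopP n b c : ip (adjop n b) c = ip b (opp_sum D h a J n c).
Proof.
rewrite /opp_sum (ip_sumr Hip) /adjop /= /lincomb (ip_suml Hip).
rewrite -(big_mkord xpredT (fun j => ip b (mo (dv j a) (h - n - 2 - j%:Z) c))).
rewrite /index_iota subn0; apply: eq_bigr => j _.
by rewrite scale1r adjP.
Qed.

Lemma opp_sum_has_par n : has_par D p (opp_sum D h a J n).
Proof.
move=> q v hv; rewrite /opp_sum.
elim/big_ind: _ => [|u w|j _]; [exact: homog0|exact: homog_add|].
apply: (mode_has_par HV) hv.
have := wt_homog HV (wt_dvp HV j ha); congr (homog D _ _).
lia.
Qed.

(** Let [v] be the component of [adjop n b] of the wrong parity. Then
    [(v|v) = (adjop n b|v) = (b|opp_sum v)], and the last two vectors have different parities. *)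
Lemma adjop_has_par n : has_par D p (adjop n).
Proof.
move=> q b hb; set v := par D (~~ (p (+) q)) (adjop n b).
have hv : homog D (~~ (p (+) q)) v by exact: homog_par.
have e : adjop n b = par D (p (+) q) (adjop n b) + v.
  rewrite -[LHS](sum_par HV) big_bool /v.
  by case: (p (+) q); rewrite //= addrC.
suff v0 : v = 0 by rewrite e v0 addr0; exact: homog_par.
apply: (ip_eq0 Hip); transitivity (ip (adjop n b) v).
  rewrite [in RHS]e (ipDl Hip) (homog_orth (homog_par HV _ _) hv) ?add0r //.
  by case: (p (+) q).
rewrite adjopP; apply: (homog_orth hb (opp_sum_has_par n hv)).
by case: (p) (q) => [] [].
Qed.

Lemma adjop_trans n : T (adjop n vc) = - n%:~R *: adjop (n - 1) vc.
Proof.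
apply: (ip_injl Hip) => c.
rewrite -(LN1 HV) LN1_adj adjopP.
have -> : opp_sum D h a J n (LL 1 c) =
    LL 1 (opp_sum D h a J n c) - n%:~R *: opp_sum D h a J (n - 1) c.
  by rewrite (L1_opp_sum HV _ _ ha (dvp_eq0 (hJ (leqnn J)))) addrK.
rewrite (ipBr Hip) -LN1_adj (L_vac HV) // (ip0l Hip) sub0r (ipZr Hip) -adjopP.
by rewrite (ipZl Hip) rmorphN /= rmorph_int mulNr.
Qed.

Lemma wt_adjop_vac n : wt (h - 2 * n - 2) (adjop n vc).
Proof.
apply: (ip_injl Hip) => c; rewrite L0_adj adjopP.
have -> : opp_sum D h a J n (LL 0 c) =
    LL 0 (opp_sum D h a J n c) + (h%:~R / 2 - n%:~R - 1) *: opp_sum D h a J n c.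
  by rewrite (L0_opp_sum HV _ _ _ ha) subrK.
rewrite (ipDr Hip) -L0_adj (L_vac HV) // (ip0l Hip) add0r (ipZr Hip) -adjopP.
rewrite (ipZl Hip) conj_half; congr (_ * _); rewrite !rmorphB rmorphM /=.
have n2 : (2 : K) != 0 by rewrite pnatr_eq0.
by field.
Qed.

(** For large [n] the weight of [adjop n vac] is negative; from there the argument descends by
    covariance, as in [mode_vac0]. *)
Lemma adjop_vac0 n : 0 <= n -> adjop n vc = 0.
Proof.
have step m : 0 <= m -> adjop (m + 1) vc = 0 -> adjop m vc = 0.
  move=> m0 e; have := adjop_trans (m + 1); rewrite e linear0 addrK => /esym/eqP.
  rewrite scaler_eq0 oppr_eq0 intr_eq0 => /orP[/eqP|/eqP //]; lia.
move=> n0; have [m Em] : exists m : nat, h - 2 * (n + m%:Z) - 2 < 0 by exists `|h|%N; lia.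
elim: m n n0 Em => [|m IH] n n0 Em.
  by rewrite addr0 in Em; exact: wt_neg (wt_adjop_vac n) Em.
by apply: step => //; apply: IH; lia.
Qed.

(** The summand at [j] is [Y(dv j a, z)^+] with exponents shifted by [h - j], and shifts preserve
    locality. *)
Lemma adjop_mloc q c :
  homog D q c -> exists N, mlocal ((-1) ^+ (p && q)) adjop (mo c) N.
Proof.
move=> hc.
have H j : exists N0, forall N, (N0 <= N)%N -> local_at D
    (fun k => adj (dv j a) (k + (h - j%:Z) - 1)) (fun k => mo c (- k - 1)) N.
  have [N hN] := adj_local (dv j a) c; exists N => M NM.
  exact: (local_shift (h - j%:Z) (local_mono NM hN)).
have [N /(_ N (leqnn N)) hN] := local_sum (iota 0 J) H; exists N.
have [+ _] := @local_mloc _ _ _ HV p q (fun k => adjop (- k - 1)) (fun k => mo c (- k - 1))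
  N (fun n => adjop_has_par _) (fun n => mode_has_par HV _ hc).
have e : (fun k v => \sum_(i <- iota 0 J) adj (dv i a) (k + (h - i%:Z) - 1) v) =
    (fun k => adjop (- k - 1) : V -> V).
  apply/funext => k; apply/funext => v; rewrite /adjop /= /lincomb.
  apply: eq_bigr => j _; rewrite scale1r; congr (adj _ _ _); lia.
rewrite e in hN => /(_ hN) hh v r k; have := hh v r k.
by congr (iter _ _ _ _ _ = _); apply/funext => i; apply/funext => j; rewrite !flipK.
Qed.

Lemma adjop_mode n v : adjop n v = mo (adjop (-1) vc) n v.
Proof.
have ht : homog D p (adjop (-1) vc).
  by have := adjop_has_par (-1) (vac_even HV); rewrite addbF.
apply/eqP; rewrite -subr_eq0; apply/eqP.
apply: (@vosa_goddard _ _ _ HV p (fun k v => adjop k v - mo (adjop (-1) vc) k v))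
  => [j u w|j|q c hc].
- by rewrite (linearD (adjop j)) (linearD (mo _ j)) opprD addrACA.
- have [j0|j0] := leP 0 j; first by rewrite adjop_vac0 // (mode_vac0 HV) // subr0.
  apply: (@trans_vanish _ _ D (fun j => adjop j vc - mo (adjop (-1) vc) j vc) (-1)) => //.
    by rewrite (mode_vac HV) subrr.
  move=> i; rewrite (linearB T) adjop_trans (trans_mode HV) (trans_vac HV) linear0 sub0r.
  by rewrite -scaleNr scalerBr.
- have [N1 h1] := adjop_mloc hc; have [N2 h2] := mode_mloc HV ht hc.
  by exists (maxn N1 N2); apply: mloc_sub => // *; exact: linearB.
Qed.

End Homogeneous.

Lemma theta_hom h a : wt h a -> exists2 a', wt h a' &
  forall b c k, ip (Yz D a' k b) c = ip b (Yinv D (twist D a) k c).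
Proof.
move=> ha; have [J hJ] := iter_L1_eq0 HV h.
have hJ' j : (J <= j)%N -> iter j (LL 1) a = 0 by exact: hJ.
(* The vector of a field is its mode [-1] on the vacuum. The sign is real, hence unaffected by the
   antilinear slot. *)
exists (wt_sign R h *: adjop h a J (-1) vc).
  apply: wt_scale; have := wt_adjop_vac J ha (-1); congr (wt_space D _ _); lia.
move=> b c k; rewrite -[k]flipK (Yinv_hom HV ha hJ') /Yz (modeZ HV) flipK.
rewrite -(adjop_mode ha hJ') (ipZl Hip) conj_wt_sign adjopP.
by rewrite -[opp_mode _ _ _ _ _ _]/(_ *: opp_sum D h a J _ c) (ipZr Hip).
Qed.

Lemma theta_ex a : exists a', forall b c k,
  ip (Yz D a' k b) c = ip b (Yinv D (twist D a) k c).
Proof.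
elim/(wt_ind HV): a => [|a b [a' ea] [b' eb]|h a /theta_hom [a' _ ea]].
- have [a' _ ea] := theta_hom (wt0 D 0); by exists a'.
- exists (a' + b') => u c k; have := Yinv_linear HV 1 a b k c; rewrite !scale1r => ->.
  by rewrite /Yz (modeD HV) (ipDl Hip) (ipDr Hip) ea eb.
- by exists a'.
Qed.

Definition theta (a : V) : V := sval (cid (theta_ex a)).

Lemma thetaP a b c k : ip (Yz D (theta a) k b) c = ip b (Yinv D (twist D a) k c).
Proof. exact: (svalP (cid (theta_ex a))). Qed.

(** At [b = vac] and [k = 0] invariance determines the vector. Antilinearity, multiplicativity and
    involutivity of [theta] all reduce in this way to an invariance formula. *)
Lemma theta_uniq a a' : (forall b c k,
  ip (Yz D a' k b) c = ip b (Yinv D (twist D a) k c)) -> theta a = a'.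
Proof.
move=> H; rewrite -(mode_vac HV (theta a)) -(mode_vac HV a').
apply: (ip_injl Hip) => c; have := H vc c 0; rewrite -thetaP /Yz oppr0 add0r.
by move=> ->.
Qed.

Lemma theta_antilinear x a b : theta (x *: a + b) = x^* *: theta a + theta b.
Proof.
apply: theta_uniq => u c k; rewrite (Yinv_linear HV) /Yz (mode_linear HV).
by rewrite (ipDl Hip) (ipDr Hip) (ipZl Hip) (ipZr Hip) conjCK !thetaP.
Qed.

Lemma wt_theta h a : wt h a -> wt h (theta a).
Proof. by move=> /theta_hom [a' wa' /theta_uniq ->]. Qed.

Lemma theta_mode_adj h a J n b c : wt h a ->
  (forall j, (J <= j)%N -> iter j (LL 1) a = 0) ->
  ip (mo (theta a) n b) c = ip b (opp_mode D h a J n c).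
Proof.
by move=> ha hJ; have := thetaP a b c (- n - 1); rewrite (Yinv_hom HV ha hJ) /Yz flipK.
Qed.

End AdjointToUnitary.

(** * Opposite modes of a product *)

(** Splits [s + 1] as [t + (s + 1 - t)]: the inductive step of a Leibniz rule in divided powers. *)
Lemma pascal_sum (K : numFieldType) (V : lmodType K) (s : nat) (F : nat -> V) :
  s.+1%:R *: \sum_(t < s.+2) F t =
  \sum_(t < s.+1) t.+1%:R *: F t.+1 + \sum_(t < s.+1) (s.+1 - t)%:R *: F t.
Proof.
transitivity (\sum_(t < s.+2) t%:R *: F t + \sum_(t < s.+2) (s.+1 - t)%:R *: F t).
  rewrite scaler_sumr -big_split; apply: eq_bigr => t _ /=.
  by rewrite -scalerDl -natrD subnKC // -ltnS.
congr (_ + _); first by rewrite big_ord_recl scale0r add0r.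
by rewrite big_ord_recr /= subnn scale0r addr0.
Qed.

Lemma alternating_binomial (K : numFieldType) s :
  \sum_(j < s.+1) (-1 : K) ^+ j * 'C(s, j)%:R = (s == 0%N)%:R.
Proof.
rewrite -expr0n -[in RHS](subrr 1) exprDn; apply: eq_bigr => j _.
by rewrite expr1n mul1r mulr_natr.
Qed.

Lemma uniform_bound (Q : nat -> nat -> Prop) (J : nat) :
  (forall p, exists N0, forall N, (N0 <= N)%N -> Q p N) ->
  exists N0, forall p N, (p < J)%N -> (N0 <= N)%N -> Q p N.
Proof.
move=> H; elim: J => [|J [N1 h1]]; first by exists 0%N.
have [N2 h2] := H J; exists (maxn N1 N2) => p N.
rewrite ltnS leq_eqVlt geq_max => /orP[/eqP ->|pJ] /andP[n1 n2]; [exact: h2|exact: h1].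
Qed.

Lemma uniform_bound2 (Q : nat -> nat -> nat -> Prop) (J : nat) :
  (forall p j, exists N0, forall N, (N0 <= N)%N -> Q p j N) ->
  exists N0, forall p j N, (p < J)%N -> (j < J)%N -> (N0 <= N)%N -> Q p j N.
Proof.
move=> H.
have [N h] := @uniform_bound (fun p N => forall j, (j < J)%N -> Q p j N) J
  (fun p => let: ex_intro N0 h := uniform_bound J (H p) in
   ex_intro _ N0 (fun N hN j hj => h j N hj hN)).
by exists N => p j M pJ jJ NM; exact: h.
Qed.

Section Leibniz.
Variables (R : realType) (V : lmodType R[i]) (D : vosa_data V).
Hypothesis HV : is_vosa D.
Local Notation K := R[i].
Local Notation mo := (mode D).
Local Notation LL := (L D).
Local Notation wt := (wt_space D).
Local Notation dv := (L1_div D).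
Variables (h : int) (a : V) (n : int).
Hypothesis ha : wt h a.
Let M : int := h - n - 2.

(* [(ad L_1)^t / t!] applied to the mode [a_(n)]. *)
Definition ad_L1_div (t : nat) (v : V) : V :=
  \sum_(p < t.+1) gbin K (M - p%:Z) (t - p) *: mo (dv p a) (n + (t - p)%N%:Z) v.

Let coef_p (p i : nat) : K := if p is q.+1 then q.+1%:R * gbin K (M - q%:Z) i else 0.
Let coef_i (p i : nat) : K :=
  if i is j.+1 then (M - 2 * p%:Z - j%:Z)%:~R * gbin K (M - p%:Z) j else 0.

(** One more [L 1] reaches [(p, i)] either from [(p - 1, i)], acting on the vector, or from
    [(p, i - 1)], raising the mode index; [coef_p] and [coef_i] are the two contributions. Pascal's
    rule and absorption add them up. *)
Lemma ad_L1_div_coef p i :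
  (p + i)%:R * gbin K (M - p%:Z) i = coef_p p i + coef_i p i.
Proof.
case: p i => [|p] [|i] //=.
- by rewrite mul0r addr0.
- by rewrite add0n add0r gbin_absorb; congr (_%:~R * _); lia.
- by rewrite !gbin0 addn0 addr0.
have -> : M - p%:Z = M - p.+1%:Z + 1 by lia.
rewrite gbinS natrD mulrDl gbin_absorb mulrDr -[RHS]addrA; congr (_ + _).
rewrite -mulrDl; congr (_ * _).
have -> : M - p.+1%:Z - i%:Z = p.+1%:Z + (M - 2 * p.+1%:Z - i%:Z) by lia.
by rewrite rmorphD.
Qed.

Lemma L1_ad_L1_div t v :
  LL 1 (ad_L1_div t v) = ad_L1_div t (LL 1 v) + t.+1%:R *: ad_L1_div t.+1 v.
Proof.
pose E (p i : nat) := mo (dv p a) (n + i%:Z) v.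
have -> : t.+1%:R *: ad_L1_div t.+1 v =
    \sum_(p < t.+2) coef_p p (t.+1 - p) *: E p (t.+1 - p)%N +
    \sum_(p < t.+2) coef_i p (t.+1 - p) *: E p (t.+1 - p)%N.
  rewrite scaler_sumr -big_split; apply: eq_bigr => p _ /=.
  by rewrite -scalerDl -ad_L1_div_coef scalerA subnKC // -ltnS.
rewrite big_ord_recl /= scale0r add0r [X in _ + (_ + X)]big_ord_recr /=.
rewrite subnn scale0r addr0 -!big_split.
have -> : LL 1 (ad_L1_div t v) = \sum_(p < t.+1)
    gbin K (M - p%:Z) (t - p) *: LL 1 (mo (dv p a) (n + (t - p)%N%:Z) v).
  by rewrite /L /ad_L1_div linear_sum; apply: eq_bigr => p _; rewrite linearZ.
apply: eq_bigr => p _ /=; have pt : (p <= t)%N by rewrite -ltnS.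
rewrite (L1_mode HV _ _ (wt_dvp HV p ha)) L1_dvp (modeZ HV) /bump /= add1n.
rewrite subSS (subSn pt) /= !scalerDr -[LHS]addrA !scalerA; congr (_ + (_ *: _ + _ *: _)).
- by rewrite mulrC.
- rewrite mulrC; congr (_%:~R * _); rewrite /M; lia.
- by congr (mo _ _ _); lia.
Qed.

(** The degree [s] part of [e^(L_1) a_(n) b = (e^(L_1) a_(n) e^(- L_1)) e^(L_1) b]. *)
Lemma leibniz s b : dv s (mo a n b) = \sum_(t < s.+1) ad_L1_div t (dv (s - t) b).
Proof.
elim: s => [|s IH].
  by rewrite big_ord1 /ad_L1_div big_ord1 /= gbin0 scale1r !dvp0 addr0.
have nz : s.+1%:R != 0 :> K by rewrite pnatr_eq0.
apply: (scalerI nz); rewrite -L1_dvp IH.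
rewrite (@pascal_sum _ _ s (fun t => ad_L1_div t (dv (s.+1 - t) b))) addrC.
have -> : LL 1 (\sum_(t < s.+1) ad_L1_div t (dv (s - t) b)) =
    \sum_(t < s.+1) LL 1 (ad_L1_div t (dv (s - t) b)) by rewrite /L linear_sum.
rewrite -big_split; apply: eq_bigr => t _ /=; have ts : (t <= s)%N by rewrite -ltnS.
rewrite L1_ad_L1_div L1_dvp subSS (subSn ts); congr (_ + _).
rewrite /ad_L1_div scaler_sumr; apply: eq_bigr => p _.
by rewrite linearZ_LR !scalerA mulrC.
Qed.

End Leibniz.

Section OppositeProduct.
Variables (R : realType) (V : lmodType R[i]) (D : vosa_data V).
Hypothesis HV : is_vosa D.
Local Notation K := R[i].
Local Notation mo := (mode D).
Local Notation LL := (L D).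
Local Notation wt := (wt_space D).
Local Notation dv := (L1_div D).
Variables (h g : int) (a b : V) (J : nat) (n : int).
Hypotheses (ha : wt h a) (hb : wt g b).
Hypotheses (aJ : forall j, (J <= j)%N -> iter j (LL 1) a = 0)
  (bJ : forall j, (J <= j)%N -> iter j (LL 1) b = 0).

Let s : K := (-1) ^+ (odd `|h|%N && odd `|g|%N).
Let M : int := h - n - 2.
Let W m c (p i j : nat) : V := gbin K (M - p%:Z) i *:
  mo (mo (dv p a) (n + i%:Z) (dv j b))
     (h + g - 2 * n - 2 - m - 2 - (p + i + j)%N%:Z) c.

Lemma dvp_aJ p : (J <= p)%N -> dv p a = 0.
Proof. by move=> /aJ; exact: dvp_eq0. Qed.

Lemma dvp_bJ p : (J <= p)%N -> dv p b = 0.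
Proof. by move=> /bJ; exact: dvp_eq0. Qed.

Lemma dvp_cut : exists I0, forall p i j, (I0 <= i)%N ->
  mo (dv p a) (n + i%:Z) (dv j b) = 0.
Proof.
have [I0 HI] : exists N0, forall p j N, (p < J)%N -> (j < J)%N -> (N0 <= N)%N ->
    mo (dv p a) (n + N%:Z) (dv j b) = 0.
  apply: uniform_bound2 => p j.
  exists `|mode_cut HV (dv p a) (dv j b) - n|%N => i hi.
  by apply: mode_cutP; lia.
exists I0 => p i j hi; have [pJ|/dvp_aJ ->] := ltnP p J; last exact: mode0.
have [jJ|/dvp_bJ ->] := ltnP j J; last exact: linear0.
exact: HI.
Qed.

(** After [leibniz] the outer mode index depends on [p + i + j] only, so the nested triangular sums
    (over [p + i + j], then [p + i], then [p]) open up into a box. *)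
Lemma opp_sum_mode m c : exists N0, forall S I, (N0 <= S)%N -> (N0 <= I)%N ->
  opp_sum D (h + g - 2 * n - 2) (mo a n b) S m c =
  \sum_(j < J) \sum_(p < J) \sum_(i < I) W m c p i j.
Proof.
have [I0 HI] := dvp_cut; exists (I0 + J + J)%N => S I hS hI.
have W0a p i j : (J <= p)%N -> W m c p i j = 0.
  by move=> /dvp_aJ e; rewrite /W e !(mode0 HV) scaler0.
have W0b p i j : (J <= j)%N -> W m c p i j = 0.
  by move=> /dvp_bJ e; rewrite /W e linear0 (mode0 HV) scaler0.
have W0i p i j : (I0 <= i)%N -> W m c p i j = 0.
  by move=> /HI e; rewrite /W e (mode0 HV) scaler0.
transitivity (\sum_(k < S) \sum_(t < k.+1)
    \sum_(p < t.+1) W m c p (t - p) (k - t)).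
  apply: eq_bigr => k _; rewrite (leibniz HV n ha) (mode_sum HV).
  apply: eq_bigr => t _; rewrite /ad_L1_div (mode_sum HV); apply: eq_bigr => p _.
  rewrite (modeZ HV) /W; congr (_ *: mo _ _ _).
  by have := ltn_ord t; have := ltn_ord p; lia.
rewrite (@sum_square _ (fun t u => \sum_(p < t.+1) W m c p (t - p) u) (J + I0) J);
  first last.
- lia.
- by move=> t u hu; apply: big1 => p _; exact: W0b.
- move=> t u ht; apply: big1 => p _.
  have [hp|hp] := leqP J p; [exact: W0a|apply: W0i; lia].
rewrite exchange_big; apply: eq_bigr => j _ /=.
rewrite (@sum_square _ (fun p i => W m c p i j) J I0) ?leqnn // => [|p i|p i]; first last.
- exact: W0i.
- exact: W0a.
apply: eq_bigr => p _; symmetry.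
apply: (@sum_widen _ I0 I (fun i => W m c p i j)) => [|i]; [lia|exact: W0i].
Qed.

Lemma opp_sum_comp l q c :
  opp_sum D h a J l (opp_sum D g b J q c) = \sum_(j < J) \sum_(p < J)
    mo (dv p a) (h - l - 2 - p%:Z) (mo (dv j b) (g - q - 2 - j%:Z) c).
Proof.
by rewrite exchange_big; apply: eq_bigr => p _ /=; rewrite /opp_sum linear_sum.
Qed.

Lemma opp_sum_comp' l q c :
  opp_sum D g b J q (opp_sum D h a J l c) = \sum_(j < J) \sum_(p < J)
    mo (dv j b) (g - q - 2 - j%:Z) (mo (dv p a) (h - l - 2 - p%:Z) c).
Proof. by apply: eq_bigr => j _ /=; rewrite /opp_sum linear_sum. Qed.

(* Borcherds' identity for [L_1^p a] and [L_1^j b], the index [r] being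
   [2 wt(a) - n - 2 - p], sums up the binomial coefficients produced by
   [e^(L_1) a_(n) e^(- L_1)]. *)
Lemma opp_mode_mode m c : exists N0, forall S L, (N0 <= S)%N -> (N0 <= L)%N ->
  opp_mode D (h + g - 2 * n - 2) (mo a n b) S m c =
  \sum_(l < L) sgbin K n l *:
    (opp_mode D g b J (m + l%:Z) (opp_mode D h a J (n - l%:Z) c)
     - (s * (-1) ^ n) *: opp_mode D h a J l%:Z (opp_mode D g b J (n + m - l%:Z) c)).
Proof.
have [N1 H1] := opp_sum_mode m c.
pose B p j N := forall I L, (N <= I)%N -> (N <= L)%N ->
  \sum_(i < I) W m c p i j =
  borcherds_partial s (mo (dv p a)) (mo (dv j b)) L (M - p%:Z) n (g - n - 2 - m - j%:Z) c.
have [N2 H2] : exists N0, forall p j N, (p < J)%N -> (j < J)%N -> (N0 <= N)%N -> B p j N.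
  apply: uniform_bound2 => p j.
  have [N0 HN] := borcherds HV (wt_homog HV (wt_dvp HV p ha))
    (wt_homog HV (wt_dvp HV j hb)) (M - p%:Z) n (g - n - 2 - m - j%:Z) c.
  exists N0 => N hN I L hI hL.
  have -> : s = (-1) ^+ (odd `|(h - 2 * p%:Z)%R|%N && odd `|(g - 2 * j%:Z)%R|%N).
    rewrite /s; congr (_ ^+ (_ && _)); lia.
  rewrite -(HN I L); [|lia|lia]; apply: eq_bigr => i _.
  by rewrite /W; congr (_ *: mo _ _ _); rewrite /M; lia.
exists (N1 + N2)%N => S L hS hL.
rewrite [LHS]/opp_mode -/(opp_sum D (h + g - 2 * n - 2) (mo a n b) S m c).
rewrite (H1 S L); [|lia|lia].
have -> : \sum_(j < J) \sum_(p < J) \sum_(i < L) W m c p i j =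
    \sum_(l < L) sgbin K n l *:
      (opp_sum D h a J l%:Z (opp_sum D g b J (n + m - l%:Z) c)
       - (s * (-1) ^ n) *: opp_sum D g b J (m + l%:Z) (opp_sum D h a J (n - l%:Z) c)).
  under eq_bigr => j _ do under eq_bigr => p _ do
    rewrite (H2 p j (N1 + N2)%N _ _ _ L L) ?leq_addl // /borcherds_partial.
  under eq_bigr => j _ do rewrite exchange_big.
  rewrite exchange_big; apply: eq_bigr => l _ /=.
  rewrite opp_sum_comp opp_sum_comp' scaler_sumr -sumrB scaler_sumr.
  apply: eq_bigr => j _; rewrite scaler_sumr -sumrB scaler_sumr.
  apply: eq_bigr => p _; congr (_ *: (_ - _ *: _)).
    by congr (mo _ _ (mo _ _ _)); rewrite /M; lia.
  by congr (mo _ _ (mo _ _ _)); rewrite /M; lia.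
rewrite scaler_sumr; apply: eq_bigr => l _.
have opp_modeE h' a' q v : opp_mode D h' a' J q v = wt_sign R h' *: opp_sum D h' a' J q v by [].
have opp_sumZ h' a' q x v : opp_sum D h' a' J q (x *: v) = x *: opp_sum D h' a' J q v.
  by rewrite /opp_sum scaler_sumr; apply: eq_bigr => j _; rewrite linearZ_LR.
rewrite !opp_modeE !opp_sumZ.
move: (opp_sum D h a J l _) (opp_sum D g b J (m + l%:Z) _) (sgbin K n l) => X Y be.
(* The sign at the weight of [a_(n) b] is [(-1)^(n+1) s] times the signs of [a] and [b]. This factor
   moves the coefficient [- s (-1)^n] from one product to the other and so reverses their order. *)
have -> : h + g - 2 * n - 2 = h + g - 2 * (n + 1) by lia.
rewrite wt_sign_sub wt_sign_add signz_mul -/s signzD expr1z.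
have ss : s * s = 1 by rewrite /s -expr2 sqrr_sign.
have nn := signz_sq R n.
move: (wt_sign R h) (wt_sign R g) ((-1) ^ n : K) nn => eh eg sg nn.
rewrite !scalerA !scalerBr !scalerA addrC -scaleNr -[X in _ = _ + X]scaleNr.
congr (_ *: _ + _ *: _); last by ring.
have -> : - (sg * -1 * (s * (eh * eg)) * be * (s * sg)) = (s * s) * (sg * sg) * be * eh * eg.
  by ring.
by rewrite ss nn; ring.
Qed.

End OppositeProduct.

(** * [theta] is an antilinear automorphism *)

Section ThetaAutomorphism.
Variables (R : realType) (V : lmodType R[i]) (D : vosa_data V) (ip : V -> V -> R[i]).
Hypotheses (HV : is_vosa D) (Hip : scalar_product ip).
Hypothesis Hmob : unitary_mobius D ip.
Hypothesis Hloc : forall a, has_local_adjoint D ip a.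

Local Notation K := R[i].
Local Notation mo := (mode D).
Local Notation T := (trans D).
Local Notation vc := (vac D).
Local Notation LL := (L D).
Local Notation wt := (wt_space D).
Local Notation dv := (L1_div D).
Local Notation th := (theta HV Hip Hmob Hloc).

Lemma thetaD a b : th (a + b) = th a + th b.
Proof.
by have := theta_antilinear HV Hip Hmob Hloc 1 a b; rewrite !scale1r rmorph1 scale1r.
Qed.

Lemma theta0 : th 0 = 0.
Proof. by apply: (@addrI _ (th 0)); rewrite -thetaD !addr0. Qed.

Lemma thetaZ x a : th (x *: a) = x^* *: th a.
Proof. by have := theta_antilinear HV Hip Hmob Hloc x a 0; rewrite theta0 !addr0. Qed.

Lemma conj_sgbin n l : (sgbin K n l)^* = sgbin K n l.
Proof.
rewrite /sgbin rmorphM rmorph_sign /gbin rmorph_prod; congr (_ * _).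
by apply: eq_bigr => i _; rewrite rmorphM fmorphV rmorph_int rmorph_nat.
Qed.

Lemma common_J h g (a b : V) : wt h a -> wt g b -> exists J,
  (forall j, (J <= j)%N -> iter j (LL 1) a = 0) /\
  (forall j, (J <= j)%N -> iter j (LL 1) b = 0).
Proof.
move=> ha hb; have [J1 h1] := iter_L1_eq0 HV h; have [J2 h2] := iter_L1_eq0 HV g.
exists (J1 + J2)%N; split=> j hj; [apply: (h1 j a ha)|apply: (h2 j b hb)]; lia.
Qed.

Lemma theta_mode_hom h g a b n : wt h a -> wt g b ->
  th (mo a n b) = mo (th a) n (th b).
Proof.
move=> ha hb; apply: theta_uniq => u c k; rewrite -[k]flipK /Yz flipK.
move: (- k - 1) => m.
have [J [aJ bJ]] := common_J ha hb.
have hab := wt_mode HV n ha hb; have [S0 hS0] := iter_L1_eq0 HV (h + g - 2 * n - 2).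
have [N0 HN] := opp_mode_mode HV n ha hb aJ bJ m c.
rewrite (Yinv_hom HV hab (J := (S0 + N0)%N)); last by move=> j hj; apply: hS0 hab _; lia.
have [N1 HB] := borcherds HV (wt_homog HV (wt_theta HV Hip Hmob Hloc ha))
  (wt_homog HV (wt_theta HV Hip Hmob Hloc hb)) 0 n m u.
pose L := (N0 + N1)%N.
rewrite (HN _ L); [|lia|lia].
(* With [r = 0] the iterated side of Borcherds' identity is its term [i = 0]. *)
transitivity (ip (borcherds_partial ((-1) ^+ (odd `|h|%N && odd `|g|%N)) (mo (th a)) (mo (th b)) L 0 n m u) c).
  congr (ip _ c); rewrite -(HB L.+1 L); [|lia|lia].
  rewrite big_ord_recl big1 => [|i _].
    by rewrite /= gbin0 scale1r ?subr0 !addr0 add0r.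
  by rewrite lift0 gbin_nat bin0n scale0r.
rewrite (ip_suml Hip) (ip_sumr Hip); apply: eq_bigr => l _.
rewrite (ipZl Hip) (ipZr Hip) conj_sgbin; congr (_ * _).
rewrite (ipBl Hip) (ipBr Hip) (ipZl Hip) (ipZr Hip _ (_ * _)).
rewrite rmorphM rmorph_sign signz_odd rmorph_sign !add0r.
(* The outer factor of each product is carried across the form, then the inner one. The order is
   thereby reversed, as [opp_mode_mode] requires. *)
rewrite 2!(theta_mode_adj HV Hip Hmob Hloc _ _ _ ha aJ, theta_mode_adj HV Hip Hmob Hloc _ _ _ hb bJ).
by rewrite 2!(theta_mode_adj HV Hip Hmob Hloc _ _ _ ha aJ, theta_mode_adj HV Hip Hmob Hloc _ _ _ hb bJ).
Qed.

Lemma theta_mode a n b : th (mo a n b) = mo (th a) n (th b).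
Proof.
elim/(wt_ind HV): a => [|a a' IH IH'|h a ha].
- by rewrite theta0 !(mode0 HV) theta0.
- by rewrite thetaD !(modeD HV) thetaD IH IH'.
elim/(wt_ind HV): b => [|b b' IH IH'|g b hb].
- by rewrite theta0 !linear0 theta0.
- by rewrite !thetaD !linearD thetaD IH IH'.
exact: theta_mode_hom ha hb.
Qed.

Lemma theta_vac : th vc = vc.
Proof.
apply: theta_uniq => b c k; rewrite -[k]flipK.
rewrite (Yinv_hom HV (wt_vac HV) (J := 1%N)) => [|[|j] // _]; last first.
  by rewrite iterSr (L_vac HV) // iter_L1_0.
rewrite /Yz flipK /opp_mode big_ord1 wt_sign_0 scale1r dvp0 !(vac_modeE HV).
have -> : (0 - (- k - 1) - 2 - 0%N%:Z == -1) = (- k - 1 == -1) by apply/eqP/eqP; lia.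
by case: eqP => // _; rewrite (ip0l Hip) (ip0r Hip).
Qed.

(** * The conformal vector and the involution *)

Section ConformalVector.
Hypothesis HV0 : forall a, wt 0 a -> exists x, a = x *: vc.
Local Notation c' := (th (conf D)).

Lemma theta_conf_adj n b d : ip (mo c' n b) d = ip b (mo (conf D) (2 - n) d).
Proof.
by have := thetaP HV Hip Hmob Hloc (conf D) b d (- n - 1); rewrite (Yinv_conf HV) /Yz flipK.
Qed.

Lemma wt_theta_conf : wt 4 c'.
Proof. exact: wt_theta (wt_conf HV). Qed.

(** Pairing with [d] gives [(vac|L_2 L_(-1) d) = (vac|L_(-1) L_2 d) + 3 (vac|L_1 d)], and both [L_1]
    and [L_(-1)] annihilate the vacuum. *)
Lemma L1_theta_conf : LL 1 c' = 0.
Proof.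
apply: (ip_injl Hip) => d; rewrite (ip0l Hip) (L1_adj Hmob) -(mode_vac HV c') theta_conf_adj.
have -> : mo (conf D) (2 - -1) (LL (-1) d) =
    LL (-1) (LL 2 d) - (-1 - 2)%:~R *: LL 1 d.
  by rewrite (@L_virasoro1 _ _ _ HV (-1) 2 d) // addrK.
rewrite (ipBr Hip) (ipZr Hip) -(L1_adj Hmob) -(LN1_adj Hmob) !(L_vac HV) //.
by rewrite !(ip0l Hip) mulr0 subr0.
Qed.

Lemma L0_theta_conf v : mo c' 1 v = LL 0 v.
Proof.
by apply: (ip_injl Hip) => d; rewrite theta_conf_adj (L0_adj Hmob) /L add0r.
Qed.

(** On the vacuum the commutator of [conf_(-1)] and [c'_(1) = L 0] is [- 2 conf]. In its expansion
    [i = 0] gives a mode 0 on the vacuum, hence zero; [i = 1] gives [- 2 c']; [i = 2] contains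
    [L 1 c' = 0]; [i = 3] gives a mode [-3] of a multiple of the vacuum, zero again; from [i = 4] on
    the weights are negative. *)
Lemma theta_conf : c' = conf D.
Proof.
have [L0 H] := commutator HV (-1) 1 vc (conf_even HV) (wt_homog HV wt_theta_conf).
have := H (L0 + 4)%N (leq_addr _ _).
pose F (i : nat) := gbin K (-1) i *: mo (mo (conf D) i%:Z c') (-1 + 1 - i%:Z) vc.
move=> {}H.
have Fi (i : nat) : (4 <= i)%N -> F i = 0.
  rewrite /F => i4; have := wt_mode HV i%:Z (wt_conf HV) wt_theta_conf.
  by move=> /(wt_neg HV Hip Hmob) ->; [by rewrite (mode0 HV) scaler0|lia].
move: H; rewrite (@sum_widen _ 4 (L0 + 4) F) ?leq_addl //.
rewrite !big_ord_recl big_ord0 /bump /= addr0 /F /=.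
have -> : mo (mo (conf D) 0 c') 0 vc = 0 by rewrite (mode_vac0 HV).
have -> : mo (conf D) (1 + 0)%N%:Z c' = LL 0 c' by rewrite /L add0r.
have -> : mo (conf D) (1 + (1 + 0))%N%:Z c' = LL 1 c' by rewrite /L.
have -> : mo (conf D) (1 + (1 + (1 + 0)))%N%:Z c' = LL 2 c' by rewrite /L.
rewrite L1_theta_conf (mode0 HV) !scaler0 !add0r.
have [x ->] := HV0 (wt_L HV 2 wt_theta_conf).
rewrite (modeZ HV) (vac_modeE HV) /= !scaler0 addr0.
rewrite wt_theta_conf (modeZ HV) (mode_vac HV) gbinN1 expr1.
rewrite !L0_theta_conf (L_vac HV) // linear0 sub0r (mode_vac HV) scale1r (wt_conf HV).
rewrite scaleN1r => /oppr_inj; apply: scalerI.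
by rewrite mulf_neq0 // ?invr_eq0 ?intr_eq0 // pnatr_eq0.
Qed.

Lemma theta_L n v : th (LL n v) = LL n (th v).
Proof. by rewrite /L theta_mode theta_conf. Qed.

Lemma theta_dvp j a : th (dv j a) = dv j (th a).
Proof.
rewrite /L1_div thetaZ fmorphV rmorph_nat; congr (_ *: _).
by elim: j => //= j IH; rewrite theta_L IH.
Qed.

Lemma dvp_dvp i j a : dv i (dv j a) = 'C(i + j, j)%:R *: dv (i + j) a.
Proof.
elim: i => [|i IH]; first by rewrite dvp0 add0n binn scale1r.
have nz : i.+1%:R != 0 :> K by rewrite pnatr_eq0.
apply: (scalerI nz); rewrite -L1_dvp IH L_scale L1_dvp !scalerA -!natrM addSn.
have := mul_bin_down (i + j).+1 j; rewrite /= -addSn addnK [X in X = _]mulnC => ->.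
by [].
Qed.

(** The opposite modes of [theta a] involve [dv j (theta a) = theta (dv j a)], whose adjoints are
    opposite modes of [dv j a]. Two divided powers compose to a binomial multiple of one, and the
    weight drop [2 j] turns the product of the two signs into [(-1)^j]. *)
Lemma theta_involutive_hom h a : wt h a -> th (th a) = a.
Proof.
move=> ha; have hta := wt_theta HV Hip Hmob Hloc ha.
have [J [aJ taJ]] := common_J ha hta.
apply: theta_uniq => b c k; rewrite -[k]flipK /Yz flipK.
move: (- k - 1) => n; rewrite (Yinv_hom HV hta taJ).
rewrite /opp_mode (ipZr Hip) (ip_sumr Hip).
have jJ (j : nat) i : (J <= i)%N -> iter i (LL 1) (dv j a) = 0.
  move=> hi; rewrite /L1_div -[X in iter _ _ X]addr0 iter_L_linear iter_L1_0 addr0.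
  by rewrite -iterD aJ ?scaler0 //; lia.
(* Grouped by [i + j], the coefficients are alternating sums of binomials, so only [i = j = 0] is
   left, with value [mo a n b]. *)
pose f (j i : nat) := ((-1) ^+ j * 'C(i + j, j)%:R) *: mo (dv (i + j) a) (n - (i + j)%N%:Z) b.
have -> : mo a n b = \sum_(j < J) \sum_(i < J) f j i.
  rewrite -(@sum_square _ f J J (J + J)%N) ?leqnn // => [|j i hj|j i hi]; first last.
  - by rewrite /f dvp_eq0 ?(mode0 HV) ?scaler0 // aJ //; lia.
  - by rewrite /f dvp_eq0 ?(mode0 HV) ?scaler0 // aJ //; lia.
  transitivity (\sum_(s < J + J) ((s : nat) == 0%N)%:R *: mo (dv s a) (n - s%:Z) b).
    case: (J) aJ => [a0|J' _].
      by rewrite big_ord0 -[a]/(iter 0 (LL 1) a) a0 // (mode0 HV).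
    rewrite addSn big_ord_recl big1 => [|s _]; last by rewrite scale0r.
    by rewrite /= scale1r dvp0 subr0 addr0.
  apply: eq_bigr => s _; rewrite -alternating_binomial scaler_suml.
  apply: eq_bigr => j _; rewrite /f subnK // -ltnS; exact: ltn_ord.
rewrite (ip_suml Hip) mulr_sumr; apply: eq_bigr => j _.
rewrite -theta_dvp (ip_herm Hip b) (theta_mode_adj HV Hip Hmob Hloc _ _ _ (wt_dvp HV j ha) (jJ j)).
rewrite -(ip_herm Hip) /opp_mode (ipZl Hip) conj_wt_sign mulrA wt_sign_sub signz_odd.
rewrite -[in X in _ = _ * X * _]signz_odd mulrCA wt_sign_sq mulr1.
rewrite (ip_suml Hip) (ip_suml Hip) mulr_sumr; apply: eq_bigr => i _.
rewrite /f (ipZl Hip) dvp_dvp (modeZ HV) (ipZl Hip) mulrA.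
congr (_ * ip (mo _ _ _) _); last by lia.
by rewrite rmorphM rmorph_sign -exprnP.
Qed.

Lemma theta_involutive a : th (th a) = a.
Proof.
elim/(wt_ind HV): a => [|a b IH IH'|h a ha]; first by rewrite !theta0.
  by rewrite !thetaD IH IH'.
exact: theta_involutive_hom ha.
Qed.

Lemma theta_is_pct : is_pct D ip th.
Proof.
split.
- exact: theta_antilinear.
- by exists th; exact: theta_involutive.
- exact: theta_mode.
- exact: theta_vac.
- exact: theta_conf.
- exact: theta_involutive.
- exact: thetaP.
Qed.

End ConformalVector.
End ThetaAutomorphism.

Theorem theorem3p28 (R : realType) (V : lmodType R[i]) (D : vosa_data V)
    (ip : V -> V -> R[i]) (HV : is_vosa D) (Hip : scalar_product ip)
    (Hnorm : normalized D ip)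
    (HV0 : wt_space D 0 = [set x *: vac D | x in [set: R[i]]]) :
  unitary_vosa D ip <->
  (unitary_mobius D ip /\ loc_adj D ip = [set: V]).
Proof.
split=> [[_ _ [th Htheta]]|[Hmob Hadj]].
  split; first exact: (pct_mobius HV Htheta).
  by apply/seteqP; split=> a _ //; exact: (pct_local_adjoint HV Hip Htheta).
have Hloc a : has_local_adjoint D ip a.
  by have : [set: V] a by []; rewrite -Hadj.
split=> //; exists (theta HV Hip Hmob Hloc); apply: theta_is_pct => a wa.
have : wt_space D 0 a by exact: wa.
by rewrite HV0 => -[x _ <-]; exists x.
Qed.
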